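(* Let $0<a<b<\infty$. There exist constants $c_1,c_2>0$, depending only on $a,b$, such that for all nonzero real-valued $f\in H^1[a,b]$ $$\|\mathcal{L}_{a,b}f\|_{L^2[0,\infty]}\;\geq\; c_1\exp\left(-c_2\frac{\|f_x\|_{L^2[a,b]}}{\|f\|_{L^2[a,b]}}\right)\|f\|_{L^2[a,b]}.$$
   Context: For $0<a<b<\infty$, the truncated Laplace transform $\mathcal{L}_{a,b}:L^2[a,b]\to L^2[0,\infty]$ is defined by $(\mathcal{L}_{a,b}f)(s)=\int_a^b e^{-st}f(t)\,dt$ for $s\ge 0$. Here $L^2[0,\infty]$ denotes $L^2$ of the half-line $[0,\infty)$, $H^1[a,b]$ is the Sobolev space of $L^2[a,b]$ functions with weak derivative in $L^2[a,b]$, and $f_x$ denotes the (weak) derivative of $f$. *)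

(* Defs.v *)
From HB Require Import structures.
From mathcomp Require Import all_boot all_order all_algebra.
From mathcomp Require Import all_classical all_reals all_analysis.

Set Implicit Arguments.
Unset Strict Implicit.
Unset Printing Implicit Defensive.

Import Order.TTheory GRing.Theory Num.Theory.
Import numFieldNormedType.Exports.

Local Open Scope classical_set_scope.
Local Open Scope ring_scope.

(* Elements of L^2(D) are represented by functions on the whole line whose
   values outside of D are irrelevant: [f \_ D] is the extension by zero. *)
Definition L2 (R : realType) (D : set R) (f : R -> R) : Prop :=
  (f \_ D : measurableTypeR R -> R) \in Lfun lebesgue_measure 2%:E.

(* If f is measurable but not square-integrable on D, then L2norm D f = 0,
   because [fine +oo = 0]. *)
Definition L2norm (R : realType) (D : set R) (f : R -> R) : R :=
  fine ('N[@lebesgue_measure R]_2%:E[EFin \o (f \_ D)])%E.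

Definition truncated_laplace (R : realType) (a b : R) (f : R -> R) (s : R) : R :=
  \int[@lebesgue_measure R]_(t in `[a, b]) (expR (- (s * t)) * f t).

(* Smooth functions with compact support in ]a, b[: a closed set contained in
   ]a, b[ is compact. *)
Definition test_function (R : realType) (a b : R) (phi : R -> R) : Prop :=
  (forall (n : nat) (x : R), derivable (derive1n n phi) x 1) /\
  closure [set x | phi x != 0] `<=` `]a, b[.

Definition weak_derivative (R : realType) (a b : R) (f fx : R -> R) : Prop :=
  forall phi : R -> R, test_function a b phi ->
    \int[@lebesgue_measure R]_(x in `[a, b]) (f x * phi^`()%classic x) =
    - \int[@lebesgue_measure R]_(x in `[a, b]) (fx x * phi x).

(* f belongs to H^1[a, b] and fx is (a representative of) its weak derivative,
   which is unique almost everywhere. *)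
Definition H1 (R : realType) (a b : R) (f fx : R -> R) : Prop :=
  [/\ L2 `[a, b] f, L2 `[a, b] fx & weak_derivative a b f fx].

(* Main.v *)
Require Import Defs.
From HB Require Import structures.
From mathcomp Require Import all_boot all_order all_algebra.
From mathcomp Require Import all_classical all_reals all_analysis.
From mathcomp Require Import measurable_realfun.
From mathcomp Require Import ring lra zify.
Import Order.TTheory GRing.Theory Num.Theory.
Import numFieldNormedType.Exports.
Local Open Scope classical_set_scope.
Local Open Scope ring_scope.

(** The squared norm of the Laplace transform g of f controls the exponential
    moments of f: the integral of g over [k, k + 1] is the integral over [a, b]
    of f(t) w(t) exp(-kt), with w(t) = (1 - exp(-t)) / t, and Cauchy-Schwarz
    bounds it by the norm G of g ([laplace_exp_moment_le]). Hence the integral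
    of f w p(exp(-t)) is at most G times the sum of the absolute values of the
    coefficients of p, for every polynomial p. It remains to pick a p that is
    close to f, for then the integral of f w p is comparable to the integral
    of f^2, and to keep its degree N proportional to the ratio |f'| / |f| of
    the L2 norms, so that its coefficients are at most exponential in that
    ratio.

    The substitution x = (exp(-t) - exp(-b)) / (exp(-a) - exp(-b)) maps [a, b]
    onto [0, 1], and p is the truncated expansion of f in the Legendre
    polynomials P_n of x. Its error is small because P_n is an eigenfunction:
    (x (1 - x) P_n')' = - n (n + 1) P_n. Integrating by parts, n (n + 1) times
    the n-th Legendre moment of f is a moment of f' against x (1 - x) P_n'. The
    functions P_n' are orthogonal for the weight x (1 - x), so that Bessel's
    inequality for f' bounds the sum of n (n + 1) (2 n + 1) times the squares
    of the moments of f by a constant times |f'|^2 ([bessel_derivative]), and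
    the part of the expansion beyond degree N is O(|f'| / N)
    ([legendre_fourier_dist]). That the expansion converges to f is the density
    of polynomials in L2, obtained from Bernstein polynomials
    ([approximable_sq_integ]).

    The weak derivative is only given against smooth functions supported inside
    ]a, b[, whereas x (1 - x) P_n' merely vanishes at the end points. The
    transition between the two is a multiplication by cutoff functions built
    from exp(-1/y), followed by dominated convergence: a cutoff has a large
    derivative only where the function to which it is applied is small
    ([weak_derivative_poly_expRN]). *)

Set Implicit Arguments.
Unset Strict Implicit.
Unset Printing Implicit Defensive.

(** * Legendre polynomials on [0, 1] *)

Section Legendre.
Context {R : numFieldType}.

(** The shifted Legendre polynomial, up to the sign (-1)^n: this normalization
    gives the value 1 at 0, which is what the computation of its norm uses. *)
Definition legendre (n : nat) : {poly R} :=
  \poly_(k < n.+1) ((-1) ^+ k * ('C(n, k) * 'C(n + k, k))%:R).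

Lemma coef_legendre n k :
  (legendre n)`_k = (-1) ^+ k * ('C(n, k) * 'C(n + k, k))%:R.
Proof.
rewrite coef_poly ltnS; case: leqP => // nk.
by rewrite bin_small// mul0n mulr0.
Qed.

Lemma size_legendre n : (size (legendre n) <= n.+1)%N.
Proof. exact: size_poly. Qed.

Lemma coef_legendre_neq0 n : (legendre n)`_n != 0.
Proof.
rewrite coef_legendre mulf_neq0 ?signr_eq0// pnatr_eq0 -lt0n muln_gt0.
by rewrite !bin_gt0 leqnn leq_addl.
Qed.

Lemma coef_legendre_rec n k :
  (legendre n)`_k.+1 * (k.+1 ^ 2)%:R =
  - ((legendre n)`_k * ((n - k) * (n + k.+1))%:R).
Proof.
rewrite !coef_legendre exprS mulN1r !mulNr; congr (- _).
rewrite -!mulrA -!natrM; congr (_ * _%:R).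
have e1 : ('C(n, k.+1) * k.+1 = 'C(n, k) * (n - k))%N.
  by rewrite mulnC mul_bin_left mulnC.
have e2 : ('C(n + k.+1, k.+1) * k.+1 = 'C(n + k, k) * (n + k.+1))%N.
  by rewrite mulnC addnS -mul_bin_diag mulnC.
by rewrite -mulnn mulnACA e1 e2 mulnACA.
Qed.

(** Comparing coefficients reduces the equation to the recurrence
    [coef_legendre_rec]. *)
Lemma legendre_ode n :
  ('X * (1 - 'X) * (legendre n)^`())^`() = - (n * n.+1)%:R *: legendre n.
Proof.
apply/polyP => k; rewrite coef_deriv coefZ.
rewrite -mulrA coefXM /= mulrBl mul1r coefB coefXM !coef_deriv.
have [kn|nk] := leqP k n; last first.
  have z j : (n < j)%N -> (legendre n)`_j = 0.
    by move=> nj; rewrite coef_legendre bin_small// mul0n mulr0.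
  case: k nk => // k nk; rewrite /= !z ?(ltnW nk)//; last by rewrite ltnW.
  by rewrite !mul0rn subrr mul0rn mulr0.
have -> : (if k == 0%N then 0 else (legendre n)`_k.-1.+1 *+ k.-1.+1) =
          (legendre n)`_k *+ k by case: k {kn}.
rewrite mulrnBl -!mulrnA -[X in X - _]mulr_natr -[X in _ - X]mulr_natr.
have := coef_legendre_rec n k; rewrite -mulnn => ->.
rewrite !natrM natrB// natrD -!natr1; ring.
Qed.

Lemma legendre0 n : (legendre n).[0] = 1.
Proof. by rewrite horner_coef0 coef_legendre bin0 addn0 bin0 mulr1. Qed.

(** The n-th polynomial has exact degree n, so leading terms can be removed one
    after the other. *)
Lemma legendre_span n (q : {poly R}) : (size q <= n)%N ->
  exists c : nat -> R, q = \sum_(k < n) c k *: legendre k.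
Proof.
elim: n q => [|n IH] q sq.
  by exists (fun=> 0); rewrite big_ord0; apply/eqP; rewrite -size_poly_leq0.
pose u := q`_n / (legendre n)`_n.
have [|c qc] := IH (q - u *: legendre n).
  apply/leq_sizeP => j; rewrite leq_eqVlt => /predU1P[<-|nj].
    by rewrite coefB coefZ /u divfK ?subrr// coef_legendre_neq0.
  rewrite coefB coefZ !nth_default ?mulr0 ?subrr//.
    by rewrite (leq_trans (size_legendre n)).
  by rewrite (leq_trans sq).
exists (fun k => if (k < n)%N then c k else u).
rewrite big_ord_recr/= ltnn; under eq_bigr do rewrite ltn_ord.
by rewrite -qc subrK.
Qed.

(** Where the exponential cost of inverting the transform comes from: the
    factors C(n + k, k) of the coefficients are at most 4^n. *)
Lemma legendre_coef_bound n (S : R) : 0 <= S ->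
  \sum_(k < n.+1) `|(legendre n)`_k| * S ^+ k <= (4 * (1 + S)) ^+ n.
Proof.
move=> S0; rewrite exprMn (exprDn 1 S) mulr_sumr; apply: ler_sum => k _.
rewrite coef_legendre normrM normrX normrN1 expr1n mul1r normr_nat expr1n mul1r.
have -> : 4 ^+ n * (S ^+ k *+ 'C(n, k)) = ('C(n, k) * 4 ^ n)%:R * S ^+ k.
  by rewrite natrM natrX -[X in _ * X = _]mulr_natr; ring.
apply: ler_wpM2r; first exact: exprn_ge0.
rewrite ler_nat leq_mul2l; apply/orP; right.
rewrite (@leq_trans (2 ^ (n + k)))//.
  rewrite -[2%N in leqRHS]/(1 + 1)%N expnDn.
  have kk : (k < (n + k).+1)%N by rewrite ltnS leq_addl.
  by rewrite (bigD1 (Ordinal kk))//= !exp1n !muln1 leq_addr.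
by rewrite -[4%N]/(2 ^ 2)%N -expnM leq_exp2l// mul2n -addnn leq_add2l -ltnS.
Qed.

(** Orthogonality uses nothing of the integral over [0, 1] but its linearity and
    the fundamental theorem of calculus. *)
Variable I : {linear {poly R} -> R^o}.
Hypothesis I_deriv : forall p, I p^`() = p.[1] - p.[0].

(** Integration by parts: the factor x (1 - x) kills the boundary terms. *)
Lemma legendre_parts n (q : {poly R}) :
  I ('X * (1 - 'X) * (legendre n)^`() * q^`()) =
      (n * n.+1)%:R * I (legendre n * q).
Proof.
have := I_deriv ('X * (1 - 'X) * (legendre n)^`() * q).
have -> : ('X * (1 - 'X) * (legendre n)^`() * q).[1] = 0.
  by rewrite !hornerM hornerX hornerD hornerN hornerX [_.[1]]hornerC subrr
      mulr0 !mul0r.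
have -> : ('X * (1 - 'X) * (legendre n)^`() * q).[0] = 0.
  by rewrite !hornerM hornerX !mul0r.
rewrite derivM legendre_ode linearD/= -scalerAl linearZ/= subrr => /eqP.
rewrite addrC addr_eq0 => /eqP ->.
by rewrite /GRing.scale/= mulNr opprK.
Qed.

(** The left-hand side of [legendre_parts] is symmetric in the two polynomials
    when q is a Legendre polynomial too, and the eigenvalues are distinct. *)
Lemma legendre_orth n m : n != m -> I (legendre n * legendre m) = 0.
Proof.
move=> nm.
have e1 := legendre_parts n (legendre m).
have e2 := legendre_parts m (legendre n).
have : ((n * n.+1)%:R - (m * m.+1)%:R) * I (legendre n * legendre m) = 0.
  rewrite mulrBl -e1 [legendre n * _]mulrC -e2.
  by rewrite -!mulrA [(legendre n)^`() * _]mulrC subrr.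
move/eqP; rewrite mulf_eq0 subr_eq0 eqr_nat => /orP[/eqP nmE|/eqP//].
exfalso; move/negP: nm; apply; apply/eqP; nia.
Qed.

Lemma legendre_orth_lower n (q : {poly R}) : (size q <= n)%N ->
  I (legendre n * q) = 0.
Proof.
move=> /legendre_span[c ->]; rewrite mulr_sumr linear_sum big1// => k _.
rewrite -scalerAr linearZ/= legendre_orth ?scaler0//.
by rewrite gtn_eqF.
Qed.

(** Integrating the derivative of (1 - x) P^2 gives
    -1 = -I(P^2) + 2 I(P P') - 2 I(P x P'). Here P' has lower degree than P, and
    x P' equals n P up to lower degree. *)
Lemma legendre_norm n : I (legendre n * legendre n) = (n.*2.+1)%:R^-1.
Proof.
pose P := legendre n.
have sP' : (size P^`() <= n)%N.
  apply: leq_trans (size_poly _ _) _.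
  by have := size_legendre n; rewrite -/P; case: (size P).
have xP' : I (P * ('X * P^`())) = n%:R * I (P * P).
  have : I (P * ('X * P^`() - n%:R *: P)) = 0.
    apply: legendre_orth_lower; apply/leq_sizeP => j nj.
    rewrite coefB coefXM coefZ coef_deriv.
    move: nj; rewrite leq_eqVlt => /predU1P[<-|nj].
      by case: (n) => [|m]; rewrite /= ?mul0r ?subr0// mulr_natl subrr.
    case: j nj => // j nj; rewrite /= nth_default ?mul0rn ?mulr0 ?subrr//.
    exact: leq_trans (size_legendre n) _.
  rewrite mulrBr linearB -scalerAr linearZ/= => /eqP.
  by rewrite subr_eq0 => /eqP ->.
have := I_deriv ((1 - 'X) * (P * P)).
have -> : ((1 - 'X) * (P * P))^`() =
    - (P * P) + 2%:R *: (P * P^`()) - 2%:R *: (P * ('X * P^`())).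
  have d1 : (1 - 'X : {poly R})^`() = - 1.
    by rewrite derivB derivX -[X in X^`() - _]/(1%:P) derivC sub0r.
  by rewrite !derivM d1 !scaler_nat; ring.
have -> : ((1 - 'X) * (P * P)).[1] = 0.
  by rewrite hornerM hornerD hornerN hornerX [_.[1]]hornerC subrr mul0r.
have -> : ((1 - 'X) * (P * P)).[0] = 1.
  rewrite !hornerM hornerD hornerN hornerX [X in X - _]hornerC subr0.
  by rewrite /P legendre0 !mul1r.
rewrite linearB linearD linearN !linearZ/= xP' (legendre_orth_lower sP').
rewrite sub0r scaler0 addr0.
rewrite /GRing.scale/= -/P => e.
apply: (@mulfI _ (n.*2.+1)%:R); first by rewrite pnatr_eq0.
rewrite mulfV ?pnatr_eq0// -addn1 -muln2 natrD natrM.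
by apply: oppr_inj; rewrite -[RHS]e; ring.
Qed.
End Legendre.

(** * Bernstein approximation *)

Section Bernstein.
Context {R : realType}.
Implicit Types (x : R) (n : nat).

Definition bernstein_basis n k x : R := x ^+ k * (1 - x) ^+ (n - k) *+ 'C(n, k).

Lemma bernstein_basis_gen n x (z : R) :
  \sum_(k < n.+1) bernstein_basis n k x * z ^+ k = (1 - x + x * z) ^+ n.
Proof.
rewrite exprDn; apply: eq_bigr => k _.
by rewrite /bernstein_basis exprMn mulrnAl; congr (_ *+ _); ring.
Qed.

(** The sums of the basis against k and k (k - 1) are the first two derivatives
    at 1 of this generating function. *)
Lemma bernstein_basis_genP n x :
  \sum_(k < n.+1) bernstein_basis n k x *: 'X^k =
      ((1 - x)%:P + x *: 'X) ^+ n :> {poly R}.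
Proof.
rewrite exprDn; apply: eq_bigr => k _.
rewrite /bernstein_basis exprZn -polyC_exp mul_polyC scalerA -scalerMnl.
by rewrite [in RHS]mulrC.
Qed.

Let genP_deriv n x : (((1 - x)%:P + x *: 'X) ^+ n)^`() =
  (n%:R * x) *: ((1 - x)%:P + x *: 'X) ^+ n.-1.
Proof.
rewrite deriv_exp derivD derivC derivZ derivX add0r alg_polyC.
by rewrite mul_polyC scalerMnl mulr_natl.
Qed.

Let genP1 n x : ((1 - x)%:P + x *: 'X).[1] ^+ n = 1.
Proof. by rewrite !hornerE subrK expr1n. Qed.

Lemma bernstein_basis_sum0 n x : \sum_(k < n.+1) bernstein_basis n k x = 1.
Proof.
have := bernstein_basis_gen n x 1; rewrite mulr1 subrK expr1n => <-.
by apply: eq_bigr => k _; rewrite expr1n mulr1.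
Qed.

Lemma bernstein_basis_sum1 n x : \sum_(k < n.+1) k%:R *
    bernstein_basis n k x = n%:R * x.
Proof.
have /(congr1 (fun p => p^`().[1])) := bernstein_basis_genP n x.
rewrite genP_deriv hornerZ horner_exp genP1 mulr1 => <-.
rewrite raddf_sum horner_sum/=; apply: eq_bigr => k _.
by rewrite derivZ derivXn hornerZ hornerMn hornerXn expr1n mulrC.
Qed.

Lemma bernstein_basis_sum2 n x :
  \sum_(k < n.+1) (k * k.-1)%:R * bernstein_basis n k x =
      (n * n.-1)%:R * x ^+ 2.
Proof.
have /(congr1 (fun p => p^`()^`().[1])) := bernstein_basis_genP n x.
rewrite genP_deriv derivZ genP_deriv !hornerZ horner_exp genP1.
rewrite mulr1 mulrACA -natrM -expr2 => <-.
rewrite !raddf_sum horner_sum/=; apply: eq_bigr => k _.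
rewrite !derivZ derivXn derivMn derivXn hornerZ !hornerMn hornerXn expr1n.
by rewrite -mulrnA mulnC mulrC.
Qed.

Lemma bernstein_basis_variance n x : \sum_(k < n.+1) (k%:R -
    n%:R * x) ^+ 2 * bernstein_basis n k x =
  n%:R * (x * (1 - x)).
Proof.
transitivity (\sum_(k < n.+1) ((k * k.-1)%:R * bernstein_basis n k x
    + ((1 - 2 * n%:R * x) * (k%:R * bernstein_basis n k x)
    + (n%:R * x) ^+ 2 * bernstein_basis n k x))).
  apply: eq_bigr => k _; have -> : (k * k.-1)%:R = k%:R ^+ 2 - k%:R :> R.
    by case: (k : nat) => [|m];
        rewrite ?subr0 ?expr0n// natrM -[m.+1.-1]/m -natr1; ring.
  ring.
rewrite !big_split/= -!mulr_sumr bernstein_basis_sum0 bernstein_basis_sum1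
    bernstein_basis_sum2.
have -> : (n * n.-1)%:R = n%:R ^+ 2 - n%:R :> R.
  by case: n => [|m]; rewrite ?subr0 ?expr0n// natrM -[m.+1.-1]/m -natr1; ring.
ring.
Qed.

Lemma bernstein_basis_ge0 n k x : 0 <= x <= 1 -> 0 <= bernstein_basis n k x.
Proof.
by move=> /andP[x0 x1]; rewrite mulrn_wge0// mulr_ge0// exprn_ge0// subr_ge0.
Qed.

Definition bernstein (g : R -> R) n : {poly R} :=
  \sum_(k < n.+1) (g (k%:R / n%:R) *+ 'C(n, k)) *: ('X^k * (1 - 'X) ^+ (n - k)).

Lemma horner_bernstein g n x :
  (bernstein g n).[x] = \sum_(k < n.+1) g (k%:R / n%:R) * bernstein_basis n k x.
Proof.
rewrite horner_sum; apply: eq_bigr => k _.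
rewrite hornerZ hornerM hornerXn horner_exp hornerD hornerN hornerX
    [_.[x]]hornerC.
by rewrite /bernstein_basis (mulrnAl (g _)) (mulrnAr (g _)).
Qed.

Lemma bernstein_le g n x (M : R) : (forall y, `|g y| <= M) -> 0 <= x <= 1 ->
  `|(bernstein g n).[x]| <= M.
Proof.
move=> gM x01; rewrite horner_bernstein (le_trans (ler_norm_sum _ _ _))//.
rewrite -[leRHS]mulr1 -(bernstein_basis_sum0 n x) mulr_sumr;
    apply: ler_sum => k _.
by rewrite normrM (ger0_norm (bernstein_basis_ge0 _ _ x01)) ler_wpM2r//
    bernstein_basis_ge0.
Qed.

(** Chebyshev's argument: nodes k / n at distance at least d from x have total
    weight at most the variance divided by d^2, which is O(1 / n). Pointwise
    convergence under a uniform bound suffices for convergence in L2. *)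
Lemma bernstein_cvg g x (M : R) : (forall y, `|g y| <= M) -> 0 <= x <= 1 ->
  {for x, continuous g} -> (bernstein g n.+1).[x] @[n --> \oo] --> g x.
Proof.
move=> gM x01 /cvgrPdist_le cg; apply/cvgrPdist_le => e e0.
have e20 : 0 < e / 2 by rewrite divr_gt0.
have [/= d d0 gd] := cg _ e20.
have M0 : 0 <= M by rewrite (le_trans _ (gM 0)).
have dist n : `|g x - (bernstein g n.+1).[x]| <=
    e / 2 + 2 * M / d ^+ 2 * n.+1%:R^-1.
  have n0 : n.+1%:R != 0 :> R by rewrite pnatr_eq0.
  have -> : g x - (bernstein g n.+1).[x] =
      \sum_(k < n.+2) (g x * bernstein_basis n.+1 k x -
          g (k%:R / n.+1%:R) * bernstein_basis n.+1 k x).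
    by rewrite horner_bernstein sumrB -mulr_sumr bernstein_basis_sum0 mulr1.
  rewrite (le_trans (ler_norm_sum _ _ _))//.
  apply: (@le_trans _ _ (\sum_(k < n.+2) (e / 2 * bernstein_basis n.+1 k x +
    2 * M / d ^+ 2 / n.+1%:R ^+ 2 * ((k%:R -
        n.+1%:R * x) ^+ 2 * bernstein_basis n.+1 k x)))).
    apply: ler_sum => k _;
        rewrite -mulrBl normrM (ger0_norm (bernstein_basis_ge0 _ _ x01)).
    rewrite mulrA -mulrDl; apply: ler_wpM2r; first exact: bernstein_basis_ge0.
    have -> : 2 * M / d ^+ 2 / n.+1%:R ^+ 2 * (k%:R - n.+1%:R * x) ^+ 2 =
              2 * M * ((x - k%:R / n.+1%:R) ^+ 2 / d ^+ 2).
      by field; rewrite addrC natr1 n0 gt_eqF.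
    have [xk|xk] := ltP `|x - k%:R / n.+1%:R| d.
      apply: le_trans (gd _ xk) _; rewrite lerDl; apply: mulr_ge0;
          first exact: mulr_ge0.
      by apply: divr_ge0; exact: sqr_ge0.
    apply: ler_wpDl; first exact: ltW.
    apply: (@le_trans _ _ (2 * M)).
      have -> : 2 * M = M + M by ring.
      by rewrite (le_trans (ler_normB _ _))// lerD.
    apply: ler_peMr; first by rewrite mulr_ge0.
    rewrite -expr_div_n -(real_normK (num_real _)).
    by rewrite exprn_ege1// normrM normfV (gtr0_norm d0) ler_pdivlMr// mul1r.
  rewrite big_split/= -!mulr_sumr bernstein_basis_sum0 bernstein_basis_variance
      mulr1 lerD2l.
  have -> : 2 * M / d ^+ 2 / n.+1%:R ^+ 2 * (n.+1%:R * (x * (1 - x))) =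
      2 * M / d ^+ 2 / n.+1%:R * (x * (1 - x)).
    by field; rewrite addrC natr1 n0 gt_eqF.
  have /andP[x0 x1] := x01; apply: ler_piMr; last by nra.
  rewrite divr_ge0// divr_ge0 ?sqr_ge0// mulr_ge0//.
have cv : 2 * M / d ^+ 2 * n.+1%:R^-1 @[n --> \oo] --> (0 : R).
  by rewrite -[X in _ --> X](mulr0 (2 * M / d ^+ 2)); apply: cvgMl_tmp;
      exact: cvg_harmonic.
move/cvgrPdist_le : cv => /(_ _ e20) ev.
near=> n; rewrite (le_trans (dist n))// [leRHS]splitr lerD2l.
have : `|0 - 2 * M / d ^+ 2 * n.+1%:R^-1| <= e / 2 by near: n.
by rewrite sub0r normrN; apply: le_trans; exact: ler_norm.
Unshelve. all: by end_near. Qed.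

End Bernstein.

(** * Integrable and square-integrable real functions *)

Section Toolbox.
Context d (T : measurableType d) (R : realType)
  (mu : {measure set T -> \bar R}) (D : set T) (mD : measurable D).
Implicit Types f g h : T -> R.

Definition integ f := mu.-integrable D (EFin \o f).

Definition sq_integ f :=
  measurable_fun D f /\ integ (fun t => f t ^+ 2).

Lemma integ_measurable f : integ f -> measurable_fun D f.
Proof. by move=> /measurable_int/measurable_EFinP. Qed.

Lemma integD f g : integ f -> integ g -> integ (fun t => f t + g t).
Proof. exact: integrableD. Qed.

Lemma integZ c f : integ f -> integ (fun t => c * f t).
Proof. exact: integrableZl. Qed.

Lemma integB f g : integ f -> integ g -> integ (fun t => f t - g t).
Proof. exact: integrableB. Qed.

Lemma integ0 : integ (fun=> 0).
Proof. exact: integrable0. Qed.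

Lemma integ_sum (I : Type) (s : seq I) (F : I -> T -> R) :
  (forall i, integ (F i)) -> integ (fun t => \sum_(i <- s) F i t).
Proof.
move=> iF; elim: s => [|i s IH].
  by under eq_fun do rewrite big_nil; exact: integ0.
by under eq_fun do rewrite big_cons; exact: integD.
Qed.

Lemma Rintegral_sum (I : Type) (s : seq I) (F : I -> T -> R) :
  (forall i, integ (F i)) ->
  \int[mu]_(t in D) (\sum_(i <- s) F i t) =
      \sum_(i <- s) \int[mu]_(t in D) F i t.
Proof.
move=> iF; elim: s => [|i s IH].
  under eq_Rintegral do rewrite big_nil.
  by rewrite big_nil Rintegral_cst// mul0r.
under eq_Rintegral do rewrite big_cons.
by rewrite big_cons RintegralD//; [rewrite IH|exact: iF|exact: integ_sum].
Qed.

Lemma RintegralN f : integ f ->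
  \int[mu]_(t in D) (- f t) = - \int[mu]_(t in D) f t.
Proof.
move=> fi; under eq_Rintegral do rewrite -mulN1r.
by rewrite RintegralZl// mulN1r.
Qed.

Lemma integ_le f g : measurable_fun D f -> integ g ->
  (forall t, D t -> `|f t| <= g t) -> integ f.
Proof.
move=> mf ig fg; apply: le_integrable ig => //; first exact/measurable_EFinP.
move=> t Dt; rewrite lee_fin (le_trans (fg t Dt))//; exact: ler_norm.
Qed.

Lemma integ_mulb f g (M : R) : integ f -> measurable_fun D g ->
  (forall t, D t -> `|g t| <= M) -> integ (fun t => f t * g t).
Proof.
move=> fi mg gM; have mf := integ_measurable fi.
apply: (@integ_le _ (fun t => M * `|f t|)); first exact: measurable_funM.
  by apply: integZ; exact: integrable_norm.
by move=> t Dt; rewrite normrM mulrC ler_wpM2r// gM.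
Qed.

Lemma integ_norm f : integ f -> integ (fun t => `|f t|).
Proof. exact: integrable_norm. Qed.

Lemma sq_integ_mul f g : sq_integ f -> sq_integ g -> integ (fun t => f t * g t).
Proof.
move=> [mf f2] [mg g2]; apply: integ_le (integD f2 g2) _.
  exact: measurable_funM.
move=> t _; rewrite ler_norml; have := sqr_ge0 (f t + g t).
have := sqr_ge0 (f t - g t); have := sqr_ge0 (f t); have := sqr_ge0 (g t).
by move=> *; apply/andP; split; nra.
Qed.

Lemma sq_integD f g : sq_integ f -> sq_integ g -> sq_integ (fun t => f t + g t).
Proof.
move=> sf sg; have fg := sq_integ_mul sf sg; case: sf sg => [mf f2] [mg g2].
split; first exact: measurable_funD.
under eq_fun do rewrite sqrrD; apply: integD => //; apply: integD => //.
by under eq_fun do rewrite -mulr_natl; exact: integZ.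
Qed.

Lemma sq_integZ c f : sq_integ f -> sq_integ (fun t => c * f t).
Proof.
move=> [mf f2]; split; first exact: measurable_funM.
by under eq_fun do rewrite exprMn; exact: integZ.
Qed.

Lemma sq_integB f g : sq_integ f -> sq_integ g -> sq_integ (fun t => f t - g t).
Proof.
move=> sf sg; under eq_fun do rewrite -mulN1r.
by apply: sq_integD => //; exact: sq_integZ.
Qed.

Lemma sq_integ_bounded f (M : R) : (mu D < +oo)%E -> measurable_fun D f ->
  (forall t, D t -> `|f t| <= M) -> sq_integ f.
Proof.
move=> Doo mf fM; split => //.
apply: measurable_bounded_integrable => //; first exact: measurable_funX.
exists (M ^+ 2); split; first exact: num_real.
move=> K MK t Dt; apply: le_trans (ltW MK).
rewrite normrX lerXn2r ?nnegrE// ?fM//.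
by rewrite (le_trans _ (fM t Dt)).
Qed.

Lemma sq_integ_integ f : (mu D < +oo)%E -> sq_integ f -> integ f.
Proof.
move=> Doo sf; have : sq_integ (fun=> 1).
  by apply: (@sq_integ_bounded _ 1) => // t _; rewrite normr1.
by move=> /(sq_integ_mul sf); under eq_fun do rewrite mulr1.
Qed.

Lemma dominated_Rintegral (f_ : nat -> T -> R) f g :
  (forall n, measurable_fun D (f_ n)) -> measurable_fun D f ->
  (forall t, D t -> f_ n t @[n --> \oo] --> f t) ->
  integ g -> (forall n t, D t -> `|f_ n t| <= g t) ->
  \int[mu]_(t in D) f_ n t @[n --> \oo] --> \int[mu]_(t in D) f t.
Proof.
move=> mf_ mf f_f ig f_g.
have [|||||fi _ cv] := @dominated_convergence _ _ _ mu D mD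
  (fun n => EFin \o f_ n) (EFin \o f) (EFin \o g).
- by move=> n; exact/measurable_EFinP.
- exact/measurable_EFinP.
- by apply/nearW => t Dt; apply: cvg_EFin; [exact: nearW|exact: f_f].
- exact: ig.
- by apply/nearW => t n Dt; rewrite lee_fin f_g.
apply: fine_cvg; rewrite fineK//; exact: integrable_fin_num.
Qed.

(** A quadratic form that takes no negative value has a nonpositive
    discriminant. *)
Lemma cauchy_schwarz f g : sq_integ f -> sq_integ g ->
  (\int[mu]_(t in D) (f t * g t)) ^+ 2 <=
  \int[mu]_(t in D) (f t ^+ 2) * \int[mu]_(t in D) (g t ^+ 2).
Proof.
move=> sf sg; have fg := sq_integ_mul sf sg.
case: sf sg => [_ f2] [_ g2].
set A := \int[mu]_(t in D) _; set B := \int[mu]_(t in D) _.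
set C := \int[mu]_(t in D) _.
have q x y : 0 <= x ^+ 2 * B + 2 * x * y * A + y ^+ 2 * C.
  have -> : x ^+ 2 * B + 2 * x * y * A + y ^+ 2 * C =
      \int[mu]_(t in D) ((x * f t + y * g t) ^+ 2).
    transitivity (\int[mu]_(t in D) (x ^+ 2 * f t ^+ 2 +
      (2 * x * y * (f t * g t) + y ^+ 2 * g t ^+ 2))); last first.
      by apply: eq_Rintegral => t _; ring.
    rewrite !RintegralD ?RintegralZl//; [by rewrite addrA|exact: integZ..|].
    by apply: integD; exact: integZ.
  by apply: Rintegral_ge0 => t _; exact: sqr_ge0.
have B0 : 0 <= B by apply: Rintegral_ge0 => t _; exact: sqr_ge0.
have C0 : 0 <= C by apply: Rintegral_ge0 => t _; exact: sqr_ge0.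
have [C00|Cp] := eqVneq C 0.
  rewrite C00 mulr0.
  have [->|A0] := eqVneq A 0; first by rewrite expr0n.
  have := q 1 (- (B + 1) / (2 * A)).
  rewrite C00 mulr0 addr0 expr1n mul1r mulr1.
  have -> : 2 * (- (B + 1) / (2 * A)) * A = - (B + 1) by field.
  lra.
have {}Cp : 0 < C by rewrite lt_def Cp.
have := q C (- A).
have -> : C ^+ 2 * B + 2 * C * - A * A + (- A) ^+ 2 * C =
    C * (B * C - A ^+ 2) by ring.
by rewrite pmulr_rge0// subr_ge0.
Qed.

End Toolbox.

(** * Smooth functions that vanish on a half-line *)

Section Flat.
Context {R : realType}.
Implicit Types (q p : {poly R}) (t y : R).

Lemma is_derive_mul (f g : R -> R) (x df dg : R) :
  is_derive x 1 f df -> is_derive x 1 g dg ->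
  is_derive x 1 (fun t => f t * g t) (df * g x + f x * dg).
Proof.
move=> hf hg; have := is_deriveM hf hg.
by rewrite addrC /GRing.scale/= [g x * df]mulrC.
Qed.

Lemma is_derive_add (f g : R -> R) (x df dg : R) :
  is_derive x 1 f df -> is_derive x 1 g dg ->
  is_derive x 1 (fun t => f t + g t) (df + dg).
Proof. by move=> hf hg; exact: is_deriveD. Qed.

Lemma is_derive_comp (f g : R -> R) (x df dg : R) :
  is_derive (g x) 1 f df -> is_derive x 1 g dg ->
  is_derive x 1 (fun t => f (g t)) (df * dg).
Proof. by move=> hf hg; exact: (@is_derive1_comp _ f g). Qed.

Lemma is_derive_near (f g : R -> R) (x df : R) : (\near x, f x = g x) ->
  is_derive x 1 f df -> is_derive x 1 g df.
Proof. exact: near_eq_is_derive. Qed.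

(** Dominates polynomials in 1/y by exp(1/y), near 0 and elsewhere at once. *)
Lemma poly_le_expR q : exists2 C, 0 <= C &
  forall u, 0 <= u -> `|q.[u]| <= C * expR u.
Proof.
exists (\sum_(i < size q) `|q`_i| * i`!%:R).
  by apply: sumr_ge0 => i _; rewrite mulr_ge0.
move=> u u0; rewrite horner_coef (le_trans (ler_norm_sum _ _ _))//.
rewrite mulr_suml; apply: ler_sum => i _; rewrite normrM -mulrA ler_wpM2l//.
rewrite normrX (ger0_norm u0); case: (i : nat) => [|n].
  by rewrite expr0 mul1r -[leLHS]expR0 ler_expR.
rewrite mulrC -ler_pdivrMr ?ltr0n ?fact_gt0//.
by rewrite (le_trans _ (expR_ge1Dxn n u0))// lerDr.
Qed.

(** For q = 1 this is the standard example exp(-1/y) of a smooth function that is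
    not analytic. The polynomial factor makes the family stable under
    derivation. *)
Definition flat q y : R := if 0 < y then q.[y^-1] * expR (- y^-1) else 0.

Lemma flat_npos q y : y <= 0 -> flat q y = 0.
Proof. by rewrite /flat leNgt; case: ifP. Qed.

(** The quadratic bound gives the derivative 0 at the origin. *)
Lemma flat_le_sqr q : exists2 C, 0 <= C & forall y, `|flat q y| <= C * y ^+ 2.
Proof.
have [C C0 qC] := poly_le_expR (q * 'X^2).
exists C => // y; have [y0|y0] := leP y 0.
  by rewrite flat_npos// normr0 mulr_ge0// sqr_ge0.
have := qC y^-1; rewrite hornerM hornerXn invr_ge0 => /(_ (ltW y0)).
rewrite /flat y0 normrM [X in _ * X]ger0_norm ?sqr_ge0// => h.
rewrite normrM [X in _ * X]ger0_norm ?expR_ge0//.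
rewrite expRN ler_pdivrMr ?expR_gt0// mulrAC -ler_pdivrMr ?exprn_gt0//.
by rewrite -exprVn.
Qed.

Lemma flat_bounded q : exists2 C, 0 <= C & forall y, `|flat q y| <= C.
Proof.
have [C C0 qC] := poly_le_expR q; exists C => // y.
have [y0|y0] := leP y 0; first by rewrite flat_npos// normr0.
rewrite /flat y0 normrM [`|expR _|]ger0_norm ?expR_ge0//.
by rewrite expRN ler_pdivrMr ?expR_gt0// qC// invr_ge0 ltW.
Qed.

Lemma is_derive_flat q y :
  is_derive y 1 (flat q) (flat ('X^2 * (q - q^`())) y).
Proof.
have [y0|y0|->] := ltgtP y 0.
- rewrite flat_npos ?ltW//.
  apply: (@is_derive_near (fun=> 0)).
  have : \forall z \near y, z < 0 by exact: lt_nbhsl.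
  by apply: filterS => z z0; rewrite flat_npos ?ltW.
- apply: (@is_derive_near (fun z => q.[z^-1] * expR (- z^-1))).
    have : \forall z \near y, 0 < z by exact: lt_nbhsr.
    by apply: filterS => z z0; rewrite /flat z0.
  have dV : is_derive y 1 (fun z : R => z^-1) (- y ^- 2).
    apply: is_derive_eq; first by apply: is_deriveV; rewrite gt_eqF.
    by rewrite /GRing.scale/= mulr1.
  have dq := is_derive_comp (is_derive_poly q y^-1) dV.
  have dE := is_derive_comp (is_derive_expR _) (is_deriveN dV).
  refine (is_derive_eq (is_derive_mul dq dE) _).
  rewrite /flat y0 /GRing.scale/= hornerM hornerXn hornerD hornerN -exprVn.
  by ring.
- apply/is_derive1_caratheodory; exists (fun z => flat q z / z); split.
  + move=> z; rewrite [flat q 0]flat_npos// !subr0.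
    by have [->|z0] := eqVneq z 0; [rewrite mulr0 flat_npos|rewrite divfK].
  + have [C C0 qC] := flat_le_sqr q.
    rewrite /prop_for /continuous_at/= flat_npos// mul0r.
    apply/cvgrPdist_le => e e0.
    have eC : 0 < e / (C + 1) by rewrite divr_gt0// ltr_wpDl.
    near=> z; rewrite sub0r normrN normrM.
    have [->|z0] := eqVneq z 0; first by rewrite invr0 normr0 mulr0 ltW.
    rewrite normfV ler_pdivrMr ?normr_gt0//.
    rewrite (le_trans (qC z))// -real_normK ?num_real// expr2 mulrA.
    rewrite ler_wpM2r//.
    have zC : `|z| <= e / (C + 1).
      near: z; exists (e / (C + 1)) => //= z.
      by rewrite /ball_ /= sub0r normrN => /ltW.
    apply: (@le_trans _ _ ((C + 1) * `|z|)); first by rewrite ler_wpM2r// lerDl.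
    by rewrite mulrC -ler_pdivlMr// ltr_wpDl.
  + by rewrite flat_npos// mul0r flat_npos.
Unshelve. all: by end_near. Qed.

Lemma flat_scale c q y : flat (c *: q) y = c * flat q y.
Proof. by rewrite /flat; case: ifP => _; rewrite ?mulr0// hornerZ mulrA. Qed.

Lemma is_derive_flat_affine q c d t : is_derive t 1
  (fun t => flat q (c * t + d)) (c * flat ('X^2 * (q - q^`())) (c * t + d)).
Proof.
have d1 : is_derive t 1 (fun t => c * t + d) c.
  have dl := is_derive_mul (is_derive_cst c t 1) (is_derive_id t 1).
  refine (is_derive_eq (is_derive_add dl (is_derive_cst d t 1)) _).
  by rewrite mul0r add0r addr0 mulr1.
rewrite mulrC; exact: (is_derive_comp (is_derive_flat _ _) d1).
Qed.

Lemma is_derive_poly_expRN p t :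
  is_derive t 1 (fun t => p.[expR (- t)]) (('X * - p^`()).[expR (- t)]).
Proof.
have d : is_derive t 1 (fun t : R => expR (- t)) (- expR (- t)).
  rewrite -mulrN1.
  exact: (is_derive_comp (is_derive_expR _) (is_deriveNid t 1)).
refine (is_derive_eq (is_derive_comp (is_derive_poly p _) d) _).
by rewrite hornerM hornerX hornerN; ring.
Qed.

(** Smoothness is obtained by exhibiting a class of derivable functions that
    contains its own derivatives; this one is just large enough for the products
    of cutoffs and exponential polynomials. *)
Inductive smooth_expr : (R -> R) -> Prop :=
| smooth_flat q c d : smooth_expr (fun t => flat q (c * t + d))
| smooth_poly_expRN p : smooth_expr (fun t => p.[expR (- t)])
| smooth_add f g of smooth_expr f & smooth_expr g :
    smooth_expr (fun t => f t + g t)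
| smooth_mul f g of smooth_expr f & smooth_expr g :
    smooth_expr (fun t => f t * g t).

Lemma smooth_expr_derive f : smooth_expr f ->
  exists2 g, smooth_expr g & forall t, is_derive t 1 f (g t).
Proof.
elim=> {f} [q c d|p|f g _ [f' sf' df] _ [g' sg' dg]|
    f g sf [f' sf' df] sg [g' sg' dg]].
- eexists; last by move=> t; exact: is_derive_flat_affine.
  under eq_fun do rewrite -flat_scale; exact: smooth_flat.
- by eexists; last exact: is_derive_poly_expRN; exact: smooth_poly_expRN.
- by exists (fun t => f' t + g' t) => [|t];
    [exact: smooth_add|exact: is_derive_add].
- exists (fun t => f' t * g t + f t * g' t) => [|t]; last exact: is_derive_mul.
  by apply: smooth_add; apply: smooth_mul.
Qed.

Lemma smooth_expr_derivable f : smooth_expr f ->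
  forall n x, derivable (derive1n n f) x 1.
Proof.
move=> sf n; have : smooth_expr (derive1n n f).
  elim: n => // n /smooth_expr_derive[g sg dg].
  rewrite derive1nS (_ : _^`()%classic = g)//.
  by apply/funext => t; rewrite derive1E; case: (dg t).
by move=> /smooth_expr_derive[g _ dg] x; case: (dg x).
Qed.

End Flat.

(** * Continuous functions on a segment *)

Section RealLine.
Context {R : realType}.
Local Notation mu := (@lebesgue_measure R).

Lemma continuous_of_derive (f f' : R -> R) :
  (forall t : R, is_derive t 1 f (f' t)) -> continuous f.
Proof.
move=> df t; apply/differentiable_continuous/derivable1_diffP.
by case: (df t).
Qed.

Lemma Rintegral_derive (F f : R -> R) (a b : R) : a < b ->
  (forall t : R, is_derive t 1 F (f t)) -> continuous f ->
  \int[mu]_(t in `[a, b]) f t = F b - F a.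
Proof.
move=> ab dF cf; rewrite /Rintegral (@continuous_FTC2 _ f F)//.
- exact: continuous_subspaceT.
- have cF := continuous_of_derive dF; split.
  + by move=> t _; case: (dF t).
  + exact/cvg_at_right_filter/cF.
  + exact/cvg_at_left_filter/cF.
- by move=> t _; rewrite derive1E; case: (dF t).
Qed.

Lemma integ_continuous (f : R -> R) (a b : R) : continuous f ->
  integ mu `[a, b] f.
Proof.
move=> cf; apply: continuous_compact_integrable; first exact: segment_compact.
exact: continuous_subspaceT.
Qed.

Lemma measurable_continuous (f : R -> R) (D : set R) : continuous f ->
  measurable_fun D f.
Proof.
move=> cf; apply: measurable_funTS; exact: continuous_measurable_fun.
Qed.

Lemma lebesgue_itv_lty (a b : R) : (mu `[a, b] < +oo)%E.
Proof.
by rewrite lebesgue_measure_itv/=; case: ifP => _; exact: ltry.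
Qed.

Lemma sq_integ_continuous (f : R -> R) (a b : R) : continuous f ->
  sq_integ mu `[a, b] f.
Proof.
move=> cf; split; first exact: measurable_continuous.
apply: integ_continuous => t;
    apply: (@continuous_comp _ _ _ f (fun x => x ^+ 2)).
  exact: cf.
exact: exprn_continuous.
Qed.

Lemma continuous_bounded_itv (f : R -> R) (a b : R) : continuous f ->
  exists2 M, 0 <= M & forall t, t \in `[a, b] -> `|f t| <= M.
Proof.
move=> cf; have [M [_ HM]] := compact_bounded
  (continuous_compact (continuous_subspaceT cf) (@segment_compact _ a b)).
exists (`|M| + 1) => [|t tab]; first by rewrite addr_ge0.
apply: HM; first by rewrite ltr_pwDr// ler_norm.
by exists t => //; rewrite inE in tab.
Qed.

Lemma Rintegral_itv_cc_oo (f : R -> R) (a b : R) : integ mu `[a, b] f ->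
  \int[mu]_(t in `[a, b]) f t = \int[mu]_(t in `]a, b[) f t.
Proof.
move=> fi.
rewrite -Rintegral_itv_bndo_bndc -?Rintegral_itv_obnd_cbnd//.
  apply: integrableS fi => //; apply: subset_itv_oo_cc.
apply: integrableS fi => // x /=; rewrite !in_itv/= => /andP[-> /ltW ->] //.
Qed.

End RealLine.

(** * The coordinate x and the density of polynomials in x *)

Section Interval.
Context {R : realType} (a b : R) (ab : a < b).
Local Notation mu := (@lebesgue_measure R).
Local Notation D := (`[a, b]%classic : set R).
Implicit Types (t : R) (p q : {poly R}).

Let mD : measurable (D : set (measurableTypeR R)). Proof. exact:
    measurable_itv. Qed.

(** [coord] is the affine function of exp(-t) that takes the values 1 at a and 0
    at b, and [density] is the opposite of its derivative: integrating against
    [density] over [a, b] is integrating over [0, 1] in the coordinate. *)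
Definition coord_scale : R := (expR (- a) - expR (- b))^-1.

Definition coordP : {poly R} := coord_scale *: ('X - (expR (- b))%:P).

Definition coord t : R := coordP.[expR (- t)].

Definition density t : R := coord_scale * expR (- t).

Lemma coordE t : coord t = coord_scale * (expR (- t) - expR (- b)).
Proof. by rewrite /coord hornerZ hornerD hornerX hornerN hornerC. Qed.

Lemma coord_scale_gt0 : 0 < coord_scale.
Proof. by rewrite invr_gt0 subr_gt0 ltr_expR ltrN2. Qed.

Lemma coord_a : coord a = 1.
Proof. by rewrite coordE mulVf// gt_eqF// subr_gt0 ltr_expR ltrN2. Qed.

Lemma coord_b : coord b = 0.
Proof. by rewrite coordE subrr mulr0. Qed.

Lemma coord_itv t : D t -> 0 <= coord t <= 1.
Proof.
move=> /=; rewrite in_itv/= => /andP[at_ tb]; apply/andP; split.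
  by rewrite coordE mulr_ge0 ?(ltW coord_scale_gt0)// subr_ge0 ler_expR lerN2.
by rewrite -[leRHS]coord_a !coordE ler_pM2l ?coord_scale_gt0// lerD2r ler_expR
    lerN2.
Qed.

Lemma density_gt0 t : 0 < density t.
Proof. by rewrite mulr_gt0 ?coord_scale_gt0 ?expR_gt0. Qed.

Lemma density_le t : D t -> density t <= density a.
Proof.
move=> /=; rewrite in_itv/= => /andP[at_ tb].
by rewrite ler_pM2l ?coord_scale_gt0// ler_expR lerN2.
Qed.

Lemma density_ge t : D t -> density b <= density t.
Proof.
move=> /=; rewrite in_itv/= => /andP[at_ tb].
by rewrite ler_pM2l ?coord_scale_gt0// ler_expR lerN2.
Qed.

Lemma horner_coord p t : p.[coord t] = (p \Po coordP).[expR (- t)].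
Proof. by rewrite horner_comp. Qed.

Lemma continuous_poly_expRN p : continuous (fun t => p.[expR (- t)]).
Proof. exact: continuous_of_derive (is_derive_poly_expRN p). Qed.

Lemma continuous_poly_coord p : continuous (fun t => p.[coord t]).
Proof. by under eq_fun do rewrite horner_coord;
    exact: continuous_poly_expRN. Qed.

Lemma is_derive_poly_coord p t :
  is_derive t 1 (fun t => p.[coord t]) (- (p^`().[coord t] * density t)).
Proof.
under eq_fun do rewrite horner_coord.
refine (is_derive_eq (is_derive_poly_expRN _ t) _).
have dsig : coordP^`() =
    coord_scale%:P by rewrite derivZ derivB derivX derivC subr0 alg_polyC.
rewrite deriv_comp dsig hornerM hornerX hornerN hornerM -horner_coord hornerC
    /density.
by ring.
Qed.

Lemma densityE t : density t = (coord_scale *: 'X).[expR (- t)].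
Proof. by rewrite hornerZ hornerX. Qed.

Lemma continuous_density : continuous density.
Proof. by rewrite (funext densityE); exact: continuous_poly_expRN. Qed.

Lemma continuous_mul (f g : R -> R) : continuous f -> continuous g ->
  continuous (fun t => f t * g t).
Proof. by move=> cf cg t; apply: cvgM; [exact: cf|exact: cg]. Qed.

(** The integral over [0, 1] of p, written on [a, b]. *)
Definition coord_int p : R := \int[mu]_(t in D) (p.[coord t] * density t).

Lemma continuous_poly_coord_density p : continuous (fun t =>
    p.[coord t] * density t).
Proof. apply: continuous_mul;
    [exact: continuous_poly_coord|exact: continuous_density]. Qed.

Lemma integ_poly_coord_density p : integ mu D (fun t =>
    p.[coord t] * density t).
Proof. exact/integ_continuous/continuous_poly_coord_density. Qed.

Fact coord_int_linear : linear (coord_int : {poly R} -> R^o).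
Proof.
move=> c p q; rewrite /coord_int.
under eq_Rintegral do rewrite hornerD hornerZ mulrDl -mulrA.
rewrite RintegralD//; [rewrite RintegralZl//| |].
- exact: integ_poly_coord_density.
- exact/integZ/integ_poly_coord_density.
- exact: integ_poly_coord_density.
Qed.

HB.instance Definition _ :=
  @GRing.isLinear.Build R {poly R} R^o *:%R coord_int coord_int_linear.

Lemma coord_int_deriv p : coord_int p^`() = p.[1] - p.[0].
Proof.
rewrite -coord_a -coord_b -[RHS]opprB.
rewrite -(@Rintegral_derive _ (fun t =>
    p.[coord t]) _ _ _ ab (is_derive_poly_coord p)).
  rewrite RintegralN ?opprK//; exact: integ_poly_coord_density.
move=> t; apply: cvgN; exact: continuous_poly_coord_density.
Qed.

Definition approximable (f : R -> R) := forall e, 0 < e ->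
  exists p, \int[mu]_(t in D) ((f t - p.[coord t]) ^+ 2) <= e.

Lemma approximable_trans (f : R -> R) : sq_integ mu D f ->
  (forall e, 0 < e -> exists g, [/\ sq_integ mu D g, approximable g &
    \int[mu]_(t in D) ((f t - g t) ^+ 2) <= e]) -> approximable f.
Proof.
move=> sf H e e0; have e4 : 0 < e / 4 by rewrite divr_gt0.
have [g [sg /(_ _ e4)[p gp] fg]] := H _ e4; exists p.
have sp : sq_integ mu D (fun t => p.[coord t]).
  exact/sq_integ_continuous/continuous_poly_coord.
have [_ i1] := sq_integB mD sf sg.
have [_ i2] := sq_integB mD sg sp.
have [_ i3] := sq_integB mD sf sp.
apply: (@le_trans _ _ (2 * \int[mu]_(t in D) ((f t - g t) ^+ 2) +
   2 * \int[mu]_(t in D) ((g t - p.[coord t]) ^+ 2))); last by lra.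
rewrite -!RintegralZl// -RintegralD//; [|exact: integZ..].
apply: le_Rintegral => //; first by apply: integD => //; exact: integZ.
move=> t _; rewrite -subr_ge0.
have -> : 2 * (f t - g t) ^+ 2 + 2 * (g t - p.[coord t]) ^+ 2 -
  (f t - p.[coord t]) ^+ 2 = (f t - 2 * g t + p.[coord t]) ^+ 2 by ring.
exact: sqr_ge0.
Qed.

(** Bernstein polynomials of g read in the coordinate converge pointwise to g and
    are uniformly bounded. *)
Lemma approximable_continuous (g : R -> R) (M : R) : continuous g ->
  (forall t, `|g t| <= M) -> approximable g.
Proof.
move=> cg gM e e0.
pose G x := g (- ln (expR (- b) + x / coord_scale)).
have k0 := coord_scale_gt0.
have GE t : G (coord t) = g t.
  by rewrite /G coordE mulrAC mulfV ?gt_eqF// mul1r addrC subrK expRK opprK.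
have GM x : `|G x| <= M by exact: gM.
have cG (x : R) : 0 <= x -> {for x, continuous G}.
  move=> x0.
  have c1 : {for x, continuous (fun x : R => expR (- b) + x / coord_scale)}.
    by apply: cvgD; [exact: cvg_cst|apply: cvgMr_tmp; exact: cvg_id].
  have c2 : {for expR (- b) + x / coord_scale, continuous (@ln R)}.
    apply: continuous_ln.
    by rewrite ltr_wpDr ?expR_gt0// divr_ge0// ltW.
  have c3 := continuousN (continuous_comp c1 c2).
  exact: (continuous_comp c3 (cg _)).
pose B n := bernstein G n.+1.
have cvB : \int[mu]_(t in D) ((g t - (B n).[coord t]) ^+ 2) @[n --> \oo] -->
    \int[mu]_(t in D) (0 : R).
  apply: (@dominated_Rintegral _ _ _ mu D mD _ _ (fun=> (2 * M) ^+ 2)).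
  - move=> n; apply: measurable_funX; apply: measurable_funB.
      exact: measurable_continuous.
    by apply: measurable_continuous; exact: continuous_poly_coord.
  - exact: measurable_cst.
  - move=> t Dt; have := @bernstein_cvg _ G (coord t) M GM (coord_itv Dt).
    have /andP[s0 _] := coord_itv Dt; move=> /(_ (cG _ s0)); rewrite GE => cv.
    have h : g t - (B n).[coord t] @[n --> \oo] --> (0 : R).
      by rewrite -(subrr (g t)); apply: cvgB cv; exact: cvg_cst.
    rewrite /= -[X in _ --> X](mulr0 0).
    exact: (cvgM h h).
  - by apply: integ_continuous => t; exact: cvg_cst.
  - move=> n t Dt; rewrite normrX lerXn2r ?nnegrE//.
      by rewrite mulr_ge0// (le_trans _ (gM t)).
    have -> : 2 * M = M + M by ring.
    by rewrite (le_trans (ler_normB _ _))// lerD// bernstein_le// coord_itv.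
move: cvB; rewrite Rintegral_cst// mul0r =>
    /cvgrPdist_le/(_ _ e0)[n _ /(_ n (leqnn n))].
rewrite /= sub0r normrN => h; exists (B n).
by rewrite (le_trans _ h)// ler_norm.
Qed.

(** For functions bounded by K, an L1 approximation is an L2 approximation once
    it is projected to [-K, K], since then (f - h)^2 <= 2 K |f - h|. *)
Lemma approximable_bounded (f : R -> R) (K : R) : measurable_fun D f ->
  (forall t, D t -> `|f t| <= K) -> approximable f.
Proof.
move=> mf fK.
have K0 : 0 <= K.
  by rewrite (le_trans (normr_ge0 (f a)))// fK//= in_itv/= lexx ltW.
have sf := sq_integ_bounded mD (lebesgue_itv_lty a b) mf fK.
have fi := sq_integ_integ mD (lebesgue_itv_lty a b) sf.
apply: approximable_trans => // e e0.
have [g_ [cg gi]] := approximation_continuous_integrable mD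
  (lebesgue_itv_lty a b) fi.
have d0 : 0 < e / (2 * K + 1) by rewrite divr_gt0// ltr_wpDl// mulr_ge0.
move=> /fine_cvgP[_ /cvgrPdist_le/(_ _ d0)[n _ /(_ n (leqnn n))]].
rewrite /= sub0r normrN => fg; pose g : R -> R := g_ n.
(* the projection of g(t) to [-K, K] *)
pose h (t : R) : R := (`|g t + K| - `|g t - K|) / 2.
have hK (t : R) : `|h t| <= K.
  rewrite /h ler_norml; have := ler_dist_dist (g t + K) (g t - K).
  have -> : g t + K - (g t - K) = K * 2 by ring.
  rewrite [`|K * 2|]ger0_norm ?mulr_ge0// ler_norml => /andP[h1 h2].
  by apply/andP; split; lra.
have ch : continuous h.
  move=> t; apply: cvgMr_tmp; apply: cvgB; apply: cvg_norm.
    by apply: cvgD; [exact: cg|exact: cvg_cst].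
  by apply: cvgB; [exact: cg|exact: cvg_cst].
have fh (t : R) : D t -> `|f t - h t| <= `|f t - g t|.
  move=> /fK; rewrite /h; move: (f t) (g t) => x y;
      rewrite ler_norml => /andP[x1 x2].
  by case: (ger0P (y + K)); case: (ger0P (y - K));
     case: (ger0P (x - y)); rewrite ler_norml => *; apply/andP; split; lra.
have sh := sq_integ_continuous a b ch.
exists h; split => //; first exact: approximable_continuous ch hK.
have fgi : integ mu D (fun t => `|f t - g t|).
  by apply: integ_norm; apply: integB => //; exact: gi.
apply: (@le_trans _ _ (2 * K * \int[mu]_(t in D) `|f t - g t|)).
  rewrite -RintegralZl//; apply: le_Rintegral => //.
  - by have [] := sq_integB mD sf sh.
  - exact: integZ.
  - move=> t Dt; rewrite -real_normK ?num_real// expr2 ler_pM ?fh//.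
    have -> : 2 * K = K + K by ring.
    by rewrite (le_trans (ler_normB _ _))// lerD// fK.
have fgI : \int[mu]_(t in D) `|f t - g t| <= e / (2 * K + 1).
  exact: le_trans (ler_norm _) fg.
apply: (@le_trans _ _ (2 * K * (e / (2 * K + 1)))).
  by rewrite ler_wpM2l// mulr_ge0.
rewrite mulrCA ler_piMr ?(ltW e0)// ler_pdivrMr ?mul1r ?lerDl//.
by rewrite ltr_wpDl// mulr_ge0.
Qed.

Lemma approximable_sq_integ (f : R -> R) : sq_integ mu D f -> approximable f.
Proof.
move=> sf; have [mf f2] := sf; apply: approximable_trans => // e e0.
(* the projection of f(t) to [-n, n] *)
pose h n (t : R) : R := (`|f t + n%:R| - `|f t - n%:R|) / 2.
have mh n : measurable_fun D (h n).
  apply: measurable_funM; last exact: measurable_cst.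
  apply: measurable_funB; apply: measurableT_comp => //.
    by apply: measurable_funD => //; exact: measurable_cst.
  by apply: measurable_funB => //; exact: measurable_cst.
have hn n t : D t -> `|h n t| <= n%:R.
  move=> _; have n0 : 0 <= n%:R :> R by [].
  rewrite /h; move: (f t) (n%:R : R) n0 => x y y0.
  by case: (ger0P (x + y)); case: (ger0P (x - y)); rewrite ler_norml => *;
     apply/andP; split; lra.
have fh n t : `|f t - h n t| <= `|f t|.
  have n0 : 0 <= n%:R :> R by [].
  rewrite /h; move: (f t) (n%:R : R) n0 => x y y0.
  by case: (ger0P (x + y)); case: (ger0P (x - y)); case: (ger0P x);
     rewrite ler_norml => *; apply/andP; split; lra.
have hE n t : `|f t| <= n%:R -> h n t = f t.
  rewrite /h ler_norml => /andP[h1 h2]; rewrite ger0_norm ?ler0_norm; lra.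
have cv : \int[mu]_(t in D) ((f t - h n t) ^+ 2) @[n --> \oo] -->
    \int[mu]_(t in D) (0 : R).
  apply: (@dominated_Rintegral _ _ _ mu D mD _ _ (fun t => f t ^+ 2)).
  - by move=> n; apply: measurable_funX; apply: measurable_funB => //;
      exact: mh.
  - exact: measurable_cst.
  - move=> t Dt; apply: cvg_near_cst; near=> n.
    rewrite hE ?subrr ?expr0n//.
    by near: n; apply: nbhs_infty_ger; exact: num_real.
  - exact: f2.
  - move=> n t Dt; rewrite normrX -[leRHS]real_normK ?num_real//.
    by rewrite lerXn2r ?nnegrE.
move: cv; rewrite Rintegral_cst// mul0r =>
    /cvgrPdist_le/(_ _ e0)[n _ /(_ n (leqnn n))].
rewrite /= sub0r normrN => fhe; exists (h n); split.
- by apply: (sq_integ_bounded mD _ (mh n) (hn n)); exact: lebesgue_itv_lty.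
- exact: approximable_bounded (mh n) (hn n).
- exact: le_trans (ler_norm _) fhe.
Unshelve. all: by end_near. Qed.

End Interval.

(** * Cutoff functions *)

Section Cutoff.
Context {R : realType}.
Implicit Types (s t : R) (p q : {poly R}).

Lemma flat_cvg q s : 0 < s ->
  flat q (n.+1%:R * s - 1) @[n --> \oo] --> q.[0].
Proof.
move=> s0; pose h (x : R) : R := q.[x] * expR (- x).
have ch : continuous h.
  pose h' (y : R) : R := (q^`()%R).[y] * expR (- y) + q.[y] * (expR (- y) * -1).
  apply: (@continuous_of_derive _ _ h') => x; apply: is_derive_mul.
have cu : (n.+1%:R * s - 1)^-1 @[n --> \oo] --> (0 : R).
  apply/cvgrPdist_le => e e0.
  near=> n; rewrite sub0r normrN.
  have un : e^-1 <= n.+1%:R * s - 1.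
    rewrite lerBrDr -ler_pdivrMr// (@le_trans _ _ n%:R)//.
      by near: n; apply: nbhs_infty_ger.
    by rewrite ler_nat.
  have u0 : 0 < n.+1%:R * s - 1 by rewrite (lt_le_trans _ un)// invr_gt0.
  by rewrite gtr0_norm ?invr_gt0// -[e]invrK lef_pV2// posrE invr_gt0.
have := cvg_comp _ _ cu (ch 0).
rewrite {2}/h oppr0 expR0 mulr1; apply: cvg_trans; apply: near_eq_cvg.
near=> n; rewrite /=/flat ifT//.
rewrite subr_gt0 -ltr_pdivrMr// (@le_lt_trans _ _ n%:R)//.
  by near: n; apply: nbhs_infty_ger.
by rewrite ltr_nat.
Unshelve. all: by end_near. Qed.

(** [ramp n] is smooth, vanishes for s <= 1/(n+1) and tends to 1 at every s > 0.
    The derivative of [ramp n] is [ramp' n]. *)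
Definition ramp n s : R := flat 1 (n.+1%:R * s - 1).
Definition ramp' n s : R := n.+1%:R * flat 'X^2 (n.+1%:R * s - 1).

Lemma ramp_cvg s : 0 < s -> ramp n s @[n --> \oo] --> (1 : R).
Proof. by move=> /(@flat_cvg 1); rewrite [_.[0]]hornerC. Qed.

(** The right-hand side is bounded uniformly in n: this is why a factor that
    vanishes at s = 0 absorbs the large derivative of the ramp. *)
Lemma ramp'E n s : s * ramp' n s = flat ('X + 'X^2) (n.+1%:R * s - 1).
Proof.
rewrite /ramp' mulrA; set u := _ - 1.
have -> : s * n.+1%:R = u + 1 by rewrite /u mulrC subrK.
rewrite /flat; case: ifPn => u0; last by rewrite mulr0.
rewrite hornerD hornerX hornerXn; field.
by rewrite gt_eqF.
Qed.

Lemma ramp'_cvg s : 0 < s -> ramp' n s @[n --> \oo] --> (0 : R).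
Proof.
move=> s0.
have -> : ramp'^~ s = fun n => s^-1 * flat ('X + 'X^2) (n.+1%:R * s - 1).
  by apply/funext => n; rewrite -ramp'E mulKf// gt_eqF.
rewrite -(mulr0 s^-1); apply: cvgMl_tmp.
by have := @flat_cvg ('X + 'X^2) _ s0; rewrite !hornerE/= expr0n/= ?addr0.
Qed.

Lemma ramp_npos n s : s <= n.+1%:R^-1 -> ramp n s = 0.
Proof.
move=> h; rewrite /ramp flat_npos// subr_le0.
by rewrite mulrC -ler_pdivlMr// div1r.
Qed.

Lemma is_derive_ramp n s t : is_derive t 1 (fun t =>
    ramp n (t - s)) (ramp' n (t - s)).
Proof.
have := is_derive_flat_affine 1 n.+1%:R (- (n.+1%:R * s) - 1) t.
rewrite -[X in X^`()]/(1%:P) derivC subr0 mulr1.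
have e x : n.+1%:R * x + (- (n.+1%:R * s) - 1) =
    n.+1%:R * (x - s) - 1 :> R by ring.
by rewrite e; under eq_fun do rewrite e.
Qed.

Lemma is_derive_rampN n s t :
  is_derive t 1 (fun t => ramp n (s - t)) (- ramp' n (s - t)).
Proof.
have := is_derive_flat_affine 1 (- n.+1%:R) (n.+1%:R * s - 1) t.
rewrite -[X in X^`()]/(1%:P) derivC subr0 mulr1.
have e x : - n.+1%:R * x + (n.+1%:R * s - 1) =
    n.+1%:R * (s - x) - 1 :> R by ring.
by rewrite e mulNr; under eq_fun do rewrite e.
Qed.

Lemma smooth_ramp n s : smooth_expr (fun t => ramp n (t - s)).
Proof.
have := smooth_flat 1 n.+1%:R (- (n.+1%:R * s) - 1).
have e x : n.+1%:R * x + (- (n.+1%:R * s) - 1) =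
    n.+1%:R * (x - s) - 1 :> R by ring.
by under eq_fun do rewrite e.
Qed.

Lemma smooth_rampN n s : smooth_expr (fun t => ramp n (s - t)).
Proof.
have := smooth_flat 1 (- n.+1%:R) (n.+1%:R * s - 1).
have e x : - n.+1%:R * x + (n.+1%:R * s - 1) =
    n.+1%:R * (s - x) - 1 :> R by ring.
by under eq_fun do rewrite e.
Qed.

End Cutoff.

(** * Integration by parts up to the end points *)

Section WeakDerivative.
Context {R : realType} (a b : R) (ab : a < b).
Local Notation mu := (@lebesgue_measure R).
Local Notation D := (`[a, b]%classic : set R).
Implicit Types (t : R) (p : {poly R}).

Let mD : measurable (D : set (measurableTypeR R)). Proof. exact:
    measurable_itv. Qed.
Let mD' : measurable (`]a, b[%classic : set (measurableTypeR R)).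
Proof. exact: measurable_itv. Qed.

Definition cutoff n t : R := ramp n (t - a) * ramp n (b - t).
Definition cutoff' n t : R :=
  ramp' n (t - a) * ramp n (b - t) + ramp n (t - a) * - ramp' n (b - t).

Lemma is_derive_cutoff n t : is_derive t 1 (cutoff n) (cutoff' n t).
Proof. exact: is_derive_mul (is_derive_ramp n a t) (is_derive_rampN n b t). Qed.

Lemma smooth_cutoff n : smooth_expr (cutoff n).
Proof. exact: smooth_mul (smooth_ramp n a) (smooth_rampN n b). Qed.

Lemma cutoff_cvg t : t \in `]a, b[ -> cutoff n t @[n --> \oo] --> (1 : R).
Proof.
rewrite in_itv/= => /andP[at_ tb]; rewrite -(mulr1 1).
by apply: cvgM; apply: ramp_cvg; rewrite subr_gt0.
Qed.

Lemma cutoff'_cvg t : t \in `]a, b[ -> cutoff' n t @[n --> \oo] --> (0 : R).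
Proof.
rewrite in_itv/= => /andP[at_ tb].
have s1 : 0 < t - a by rewrite subr_gt0.
have s2 : 0 < b - t by rewrite subr_gt0.
have -> : 0 = 0 * 1 + 1 * - 0 :> R by ring.
apply: cvgD; apply: cvgM; [exact: ramp'_cvg|exact: ramp_cvg|exact: ramp_cvg|].
by apply: cvgN; exact: ramp'_cvg.
Qed.

Lemma test_function_cutoff n p :
  test_function a b (fun t => cutoff n t * p.[expR (- t)]).
Proof.
split.
  apply: smooth_expr_derivable; apply: smooth_mul; first exact: smooth_cutoff.
  exact: smooth_poly_expRN.
have d0 : 0 < n.+1%:R^-1 :> R by rewrite invr_gt0.
apply: (@subset_trans _ `[a + n.+1%:R^-1, b - n.+1%:R^-1]).
  rewrite [X in _ `<=` X](closure_id _).1; last exact: itv_closed.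
  apply: closure_subset => t /= h; rewrite in_itv/=; apply/andP; split.
    rewrite leNgt; apply: contra h => h.
    by rewrite /cutoff ramp_npos ?mul0r// lerBlDl ltW.
  rewrite leNgt; apply: contra h => h.
  by rewrite /cutoff (@ramp_npos _ n (b -
      t)) ?mulr0 ?mul0r// lerBlDl -lerBlDr ltW.
move=> t /=; rewrite !in_itv/= => /andP[h1 h2].
by rewrite (lt_le_trans _ h1) ?ltrDl// (le_lt_trans h2)// gtrBl.
Qed.

(** A function phi that vanishes at a and b is bounded by L |t - a| and
    L |b - t|, so the products of phi with the derivatives of the cutoffs are
    bounded and tend to 0 pointwise; all limits are then taken by dominated
    convergence. *)
Lemma weak_derivative_poly_expRN (f fx : R -> R) p :
  integ mu D f -> integ mu D fx -> weak_derivative a b f fx ->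
  p.[expR (- a)] = 0 -> p.[expR (- b)] = 0 ->
  \int[mu]_(t in D) (f t * ('X * - p^`()).[expR (- t)]) =
  - \int[mu]_(t in D) (fx t * p.[expR (- t)]).
Proof.
move=> fi fxi wd pa pb.
pose phi t := p.[expR (- t)]; pose phi' t := ('X * - p^`()).[expR (- t)].
have dphi t : is_derive t 1 phi (phi' t) by exact: is_derive_poly_expRN.
have cphi : continuous phi by exact: continuous_poly_expRN.
have cphi' : continuous phi' by exact: continuous_poly_expRN.
have [L L0 phi'L] := continuous_bounded_itv a b cphi'.
have phi_a t : t \in `]a, b[ -> `|phi t| <= L * `|t - a|.
  rewrite in_itv/= => /andP[at_ tb].
  have [|c] := @MVT_segment _ phi phi' a t (ltW at_).
    exact: continuous_subspaceT.
  rewrite {2}/phi pa subr0 => cat ->; rewrite normrM ler_wpM2r// phi'L//.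
  by move: cat; rewrite !in_itv/= => /andP[-> h]; rewrite (le_trans h)// ltW.
have phi_b t : t \in `]a, b[ -> `|phi t| <= L * `|b - t|.
  rewrite in_itv/= => /andP[at_ tb].
  have [|c] := @MVT_segment _ phi phi' t b (ltW tb).
    exact: continuous_subspaceT.
  rewrite {1}/phi pb sub0r => ctb h.
  rewrite -normrN h normrM ler_wpM2r// phi'L//.
  by move: ctb; rewrite !in_itv/= => /andP[h1 ->];
      rewrite (le_trans _ h1)// ltW.
have [M M0 phiM] := continuous_bounded_itv a b cphi.
have [C0 C00 rC0] := flat_bounded (1 : {poly R}).
have [C1 C10 rC1] := flat_bounded ('X + 'X^2 : {poly R}).
have cutM n t : `|cutoff n t| <= C0 * C0 by rewrite normrM ler_pM// rC0.
have cut'M n t : t \in `]a, b[ -> `|cutoff' n t * phi t| <= 2 * (L * C1 * C0).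
  move=> tab.
  have b1 : `|ramp' n (t - a) * phi t| <= L * C1.
    rewrite normrM mulrC (le_trans (ler_wpM2r _ (phi_a _ tab)))//.
    by rewrite -mulrA -normrM ramp'E ler_wpM2l.
  have b2 : `|ramp' n (b - t) * phi t| <= L * C1.
    rewrite normrM mulrC (le_trans (ler_wpM2r _ (phi_b _ tab)))//.
    by rewrite -mulrA -normrM ramp'E ler_wpM2l.
  have -> : cutoff' n t * phi t = (ramp' n (t - a) * phi t) * ramp n (b - t) -
     (ramp' n (b - t) * phi t) * ramp n (t - a) by rewrite /cutoff'; ring.
  rewrite (le_trans (ler_normB _ _))// !normrM.
  have -> : 2 * (L * C1 * C0) = L * C1 * C0 + L * C1 * C0 by ring.
  by rewrite -!normrM lerD// normrM ler_pM// rC0.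
have ccut n : continuous (cutoff n).
  exact: continuous_of_derive (is_derive_cutoff n).
have ccut' n : continuous (cutoff' n).
  have [g sg dg] := smooth_expr_derive (smooth_cutoff n).
  have -> : cutoff' n = g.
    apply/funext => t; case: (is_derive_cutoff n t) => _ <-.
    by case: (dg t).
  have [g' _ dg'] := smooth_expr_derive sg.
  exact: continuous_of_derive dg'.
pose psi n t := cutoff n t * phi t.
pose psi' n t := cutoff' n t * phi t + cutoff n t * phi' t.
have dpsi n t : is_derive t 1 (psi n) (psi' n t).
  exact: is_derive_mul (is_derive_cutoff n t) (dphi t).
have cpsi n : continuous (psi n) by exact: continuous_mul.
have cpsi' n : continuous (psi' n).
  by move=> t; apply: cvgD; apply: cvgM; [exact: ccut'|exact: cphi|
    exact: ccut|exact: cphi'].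
have integ_mulc (g h : R -> R) : integ mu D g -> continuous h ->
    integ mu D (fun t => g t * h t).
  move=> gi ch; have [K _ hK] := continuous_bounded_itv a b ch.
  apply: (@integ_mulb _ _ _ mu _ mD g h K gi) => [|t Dt].
    exact: measurable_continuous.
  by apply: hK; rewrite inE.
have fioo (g : R -> R) : integ mu D g -> integ mu `]a, b[ g.
  by move=> gi; apply: integrableS gi => //; exact: subset_itv_oo_cc.
have e n : \int[mu]_(t in `]a, b[) (f t * psi' n t) =
    - \int[mu]_(t in `]a, b[) (fx t * psi n t).
  rewrite -!Rintegral_itv_cc_oo; [|exact: integ_mulc..].
  have := wd _ (test_function_cutoff n p).
  rewrite (_ : (_^`())%classic = psi' n)//.
  by apply/funext => t; rewrite derive1E; case: (dpsi n t).
rewrite !Rintegral_itv_cc_oo; [|exact: integ_mulc..].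
have cv1 : \int[mu]_(t in `]a, b[) (f t * psi' n t) @[n --> \oo] -->
           \int[mu]_(t in `]a, b[) (f t * phi' t).
  apply: (@dominated_Rintegral _ _ _ mu _ mD' _ _
    (fun t => (2 * (L * C1 * C0) + C0 * C0 * L) * `|f t|)).
  - move=> n; apply: integ_measurable; apply: fioo; exact: integ_mulc.
  - apply: integ_measurable; apply: fioo; exact: integ_mulc.
  - move=> t tab; apply: cvgMl_tmp.
    have -> : phi' t = 0 * phi t + 1 * phi' t by ring.
    have tab' : t \in `]a, b[ by rewrite inE.
    by apply: cvgD; apply: cvgMr_tmp; [exact: cutoff'_cvg|exact: cutoff_cvg].
  - by apply: integZ => //; apply: integ_norm; exact: fioo.
  - move=> n t tab; have tab' : t \in `]a, b[ by rewrite inE.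
    rewrite normrM mulrC ler_wpM2r// (le_trans (ler_normD _ _))//.
    rewrite lerD ?cut'M// normrM ler_pM// phi'L//.
    exact: (subset_itv_oo_cc tab).
have cv2 : \int[mu]_(t in `]a, b[) (fx t * psi n t) @[n --> \oo] -->
           \int[mu]_(t in `]a, b[) (fx t * phi t).
  apply: (@dominated_Rintegral _ _ _ mu _ mD' _ _
    (fun t => (C0 * C0 * M) * `|fx t|)).
  - move=> n; apply: integ_measurable; apply: fioo; exact: integ_mulc.
  - apply: integ_measurable; apply: fioo; exact: integ_mulc.
  - move=> t tab; apply: cvgMl_tmp.
    have tab' : t \in `]a, b[ by rewrite inE.
    have -> : phi t = 1 * phi t by ring.
    by apply: cvgMr_tmp; exact: cutoff_cvg.
  - by apply: integZ => //; apply: integ_norm; exact: fioo.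
  - move=> n t tab.
    rewrite normrM mulrC ler_wpM2r// normrM ler_pM// phiM//.
    exact: (subset_itv_oo_cc tab).
have {}cv2 : \int[mu]_(t in `]a, b[) (f t * psi' n t) @[n --> \oo] -->
           - \int[mu]_(t in `]a, b[) (fx t * phi t).
  by under eq_cvg do rewrite e; exact: cvgN.
exact: (cvg_unique _ cv1 cv2).
Qed.

End WeakDerivative.

(** * The L2 norm as an integral *)

Section L2Norm.
Context {R : realType}.
Local Notation mu := (@lebesgue_measure R).

(** This holds without any integrability assumption, because both sides are 0
    when the integral is infinite. *)
Lemma L2norm_sqrt (D : set R) (f : R -> R) :
  L2norm D f = Num.sqrt (\int[mu]_(t in D) (f t ^+ 2)).
Proof.
rewrite /L2norm unlock /= Rintegral_mkcond /Rintegral.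
have -> : (\int[mu]_x `|((f \_ D) x)%:E| `^ 2)%E =
          (\int[mu]_x (((fun t => f t ^+ 2) \_ D) x)%:E)%E.
  apply: eq_integral => x _; rewrite /= powR_mulrn//.
  rewrite real_normK ?num_real//; congr EFin.
  by rewrite !patchE; case: ifP => _; rewrite ?expr0n.
rewrite fine_poweR powR12_sqrt//; apply: fine_ge0; apply: integral_ge0 => x _.
by rewrite lee_fin patchE; case: ifP => _ //; exact: sqr_ge0.
Qed.

Lemma L2norm_ge0 (D : set R) (f : R -> R) : 0 <= L2norm D f.
Proof. by rewrite L2norm_sqrt sqrtr_ge0. Qed.

Lemma L2norm_sqr (D : set R) (f : R -> R) :
  L2norm D f ^+ 2 = \int[mu]_(t in D) (f t ^+ 2).
Proof.
by rewrite L2norm_sqrt sqr_sqrtr// Rintegral_ge0// => t _; exact: sqr_ge0.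
Qed.

Lemma L2_sq_integ (a b : R) (f : R -> R) : L2 `[a, b] f -> sq_integ mu `[a, b]
    f.
Proof.
move=> f2; have := Lfun2_integrable_sqr f2.
move: f2; rewrite /L2 inE/= => /andP[/[!inE]/= mf _] i2.
have mD : measurable (`[a, b]%classic : set (measurableTypeR R))
    by exact: measurable_itv.
split.
  move/(measurable_restrictT _ mD): mf => //.
rewrite /integ (integrable_mkcond _ mD).
move: i2; congr (_.-integrable _ _); apply/funext => x /=.
by rewrite !patchE; case: ifP => _; rewrite ?expr0n.
Qed.

End L2Norm.

(** * Exchanging integrals in the truncated Laplace transform *)

Section Laplace.
Context {R : realType} (a b : R) (ha : 0 < a).
Local Notation mu := (@lebesgue_measure R).
Local Notation D := (`[a, b]%classic : set R).
Local Notation T := (measurableTypeR R).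

Let mD : measurable (D : set T). Proof. exact: measurable_itv. Qed.

Lemma continuous_expRZ (c : R) : continuous (fun s : R => expR (- (c * s))).
Proof.
apply: (@continuous_of_derive _ _ (fun s => expR (- (c * s)) * (- c))) => s.
apply: (is_derive_comp (is_derive_expR _)).
have dl := is_derive_mul (is_derive_cst c s 1) (is_derive_id s 1).
refine (is_derive_eq (is_deriveN dl) _).
by rewrite mul0r add0r mulr1.
Qed.

(** Majorant of the transform at infinity, with c = a, and of its square, with
    c = 2 a. *)
Lemma integ_expR_half_line (c : R) : 0 < c ->
  integ mu `[0, +oo[ (fun s => expR (- (c * s))).
Proof.
move=> c0.
have dF (x : R) : is_derive x 1 (fun s =>
    - c^-1 * expR (- (c * s))) (expR (- (c * x))).
  have dl := is_derive_mul (is_derive_cst c x 1) (is_derive_id x 1).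
  have dE := is_derive_comp (is_derive_expR _) (is_deriveN dl).
  refine (is_derive_eq (is_derive_mul (is_derive_cst (- c^-1) x 1) dE) _).
  by rewrite /cst !mul0r !add0r mulr1; field; rewrite gt_eqF.
apply/integrableP; split.
  apply/measurable_EFinP; apply: measurable_continuous; exact: continuous_expRZ.
under eq_integral do rewrite gee0_abs ?lee_fin ?expR_ge0//.
rewrite (@ge0_continuous_FTC2y _ _ (fun s => - c^-1 * expR (- (c * s))) 0 0)//.
- by rewrite -EFinB ltry.
- by apply: continuous_subspaceT; exact: continuous_expRZ.
- rewrite -(mulr0 (- c^-1)); apply: cvgMl_tmp.
  apply: (@cvg_comp _ _ _ (fun s => c * s) (fun x : R => expR (- x)));
      last exact: cvgr_expR.
  exact: gt0_cvgMry.
- apply: cvg_at_right_filter.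
  exact: (continuous_of_derive dF).
- by move=> x _; rewrite derive1E; case: (dF x).
Qed.

Variable f : R -> R.
Hypothesis fi : integ mu D f.

Let f0 : T -> R := f \_ D.

Let f0i : mu.-integrable setT (EFin \o f0).
Proof.
have := fi; rewrite /integ (integrable_mkcond _ mD); congr (_.-integrable _ _).
by apply/funext => x; rewrite /= /f0 !patchE; case: ifP.
Qed.

Let mf0 : measurable_fun setT f0.
Proof. by have := f0i => /measurable_int/measurable_EFinP. Qed.

Section Slab.
Variable A : set T.
Hypotheses (mA : measurable A) (A0 : A `<=` `[0, +oo[).

Let F (z : T * T) : R := expR (- (z.1 * z.2)) * f0 z.2 * \1_A z.1.

Let mF : measurable_fun setT F.
Proof.
apply: measurable_funM.
  apply: measurable_funM.
    apply: (measurableT_comp (@measurable_expR R)).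
    apply: (measurableT_comp (@oppr_measurable R setT)).
    by apply: measurable_funM.
  exact: (measurableT_comp mf0).
apply: (@measurableT_comp _ _ _ _ _ _ (\1_A : T -> R)) => //.
Qed.

(** The majorant is a product of two integrable functions of one variable. *)
Let F_le s t : `|F (s, t)| <= (expR (- (a * s)) * \1_A s) * `|f0 t|.
Proof.
rewrite /F/= !normrM (ger0_norm (expR_ge0 _)) [X in _ * _ * X]ger0_norm//.
have [As|nAs] := pselect (A s); last first.
  by rewrite [\1_A s]indicE memNset// !mulr0 mul0r.
rewrite [leRHS]mulrAC ler_wpM2r// /f0 patchE.
case: ifPn => [tD|_]; last by rewrite normr0 !mulr0.
rewrite ler_wpM2r// ler_expR lerN2 mulrC ler_wpM2l//.
  by move: (A0 As); rewrite /= in_itv/= andbT.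
by move: tD; rewrite inE/= in_itv/= => /andP[].
Qed.

Let FI : (mu \x mu)%E.-integrable setT (EFin \o F).
Proof.
apply/integrable12ltyP; first exact/measurable_EFinP.
have eA : mu.-integrable setT (fun s : T => (expR (- (a * s)) * \1_A s)%:E).
  have := integ_expR_half_line ha => ei.
  have eiA : mu.-integrable A (EFin \o (fun s : T => expR (- (a * s)))).
    by apply: integrableS ei => //; exact: measurable_itv.
  move: eiA; rewrite (integrable_mkcond _ mA); congr (_.-integrable _ _).
  apply/funext => s; rewrite /= patchE indicE.
  by case: (s \in A); rewrite ?mulr1 ?mulr0.
have nf0 : mu.-integrable setT (EFin \o (fun t =>
    `|f0 t|)) by exact: integrable_norm.
pose C := \int[mu]_t `|f0 t|.
apply: (@le_lt_trans _ _ (\int[mu]_s (C%:E * (expR (- (a * s)) *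
    \1_A s)%:E))%E).
  apply: ge0_le_integral => //.
  - by move=> s _; apply: integral_ge0.
  - apply: (@measurable_fun_fubini_tonelli_F _ _ _ _ _ mu (abse \o (EFin \o
      F))) => [|z].
      by apply: measurableT_comp => //; exact/measurable_EFinP.
    exact: abse_ge0.
  - by have /measurable_int := integrableZl measurableT C eA.
  - move=> s _.
    have -> : (C%:E * (expR (- (a * s)) * \1_A s)%:E)%E =
       (\int[mu]_t ((expR (- (a * s)) * \1_A s)%:E * `|f0 t|%:E))%E.
      rewrite (integralZl measurableT nf0).
      by rewrite muleC /C /Rintegral fineK//; exact: integrable_fin_num nf0.
    apply: ge0_le_integral => //.
    + apply: measurableT_comp => //; apply/measurable_EFinP.
      apply: (measurableT_comp mF); exact: measurable_pair1.
    + by have /measurable_int :=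
        integrableZl measurableT (expR (- (a * s)) * \1_A s) nf0.
    + by move=> t _; rewrite -EFinM lee_fin F_le.
apply: integrable_lty; first exact: measurableT.
by have := integrableZl measurableT C eA.
Qed.

Let inner1 s : (\int[mu]_t (F (s, t))%:E)%E =
  ((truncated_laplace a b f \_ A) s)%:E.
Proof.
rewrite /truncated_laplace patchE; case: ifPn => [As|nAs]; last first.
  rewrite /F/=; under eq_integral do rewrite indicE (negbTE nAs) mulr0.
  by rewrite integral0.
have sA : 0 <= s by move: As; rewrite inE => /A0; rewrite /= in_itv/= andbT.
have ft : integ mu D (fun t => expR (- (s * t)) * f t).
  have mE : measurable_fun D (fun t => expR (- (s * t))).
    by apply: measurable_continuous; exact: continuous_expRZ.
  apply: (@integ_le _ _ _ mu D mD _ (fun t => `|f t|)).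
  - by apply: measurable_funM => //; exact: integ_measurable fi.
  - exact: integ_norm fi.
  - move=> t Dt; rewrite normrM ger0_norm ?expR_ge0// ler_piMl//.
    rewrite -[leRHS]expR0 ler_expR oppr_le0 mulr_ge0//.
    by move: Dt; rewrite /= in_itv/= => /andP[h _];
        rewrite (le_trans _ h)// ltW.
rewrite /Rintegral fineK; last exact: integrable_fin_num ft.
rewrite [in RHS]integral_mkcond; apply: eq_integral => t _.
rewrite /F /= indicE As mulr1 /f0 !patchE.
by case: ifP => _; rewrite ?mulr0.
Qed.

Let inner2 t : (\int[mu]_s (F (s, t))%:E)%E =
  (((fun t => f t * \int[mu]_(s in A) expR (- (s * t))) \_ D) t)%:E.
Proof.
rewrite patchE; case: ifPn => [Dt|nDt]; last first.
  rewrite /F/=; under eq_integral do rewrite /f0 patchE (negbTE nDt) mulr0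
      mul0r.
  by rewrite integral0.
have t0 : 0 < t.
  by move: Dt; rewrite inE/= in_itv/= => /andP[h _]; exact: lt_le_trans h.
have eA : integ mu A (fun s => expR (- (s * t))).
  have := integ_expR_half_line t0.
  rewrite (_ : (fun s => _) = (fun s => expR (- (s * t)))); last first.
    by apply/funext => s; rewrite mulrC.
  by apply: integrableS => //; exact: measurable_itv.
pose e : T -> R := (fun s => expR (- (s * t))) \_ A.
have eA' : mu.-integrable setT (EFin \o e).
  move: eA; rewrite /integ (integrable_mkcond _ mA).
  by rewrite restrict_EFin.
transitivity (\int[mu]_s ((f t)%:E * (e s)%:E))%E.
  apply: eq_integral => s _; rewrite /F /f0 /e/= !patchE Dt indicE.
  by case: (s \in A); rewrite -EFinM/= ?mulr1 ?mulr0// [in RHS]mulrC.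
rewrite (integralZl measurableT eA') EFinM; congr (_ * _)%E.
by rewrite Rintegral_mkcond /Rintegral fineK//; exact: integrable_fin_num eA'.
Qed.

Lemma integ_truncated_laplace : integ mu A (truncated_laplace a b f).
Proof.
rewrite /integ (integrable_mkcond _ mA).
have := integrable_fubini_F FI; congr (_.-integrable _ _).
by apply/funext => s; rewrite /fubini_F inner1 restrict_EFin.
Qed.

(** Fubini's theorem, on the product of A and [a, b]. *)
Lemma Rintegral_truncated_laplace :
  \int[mu]_(s in A) truncated_laplace a b f s =
  \int[mu]_(t in D) (f t * \int[mu]_(s in A) expR (- (s * t))).
Proof.
have := Fubini FI; rewrite [X in X = _](_ : _ =
   \int[mu]_s ((truncated_laplace a b f \_ A) s)%:E)%E; last first.
  by apply: eq_integral => s _; rewrite -inner1.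
rewrite [X in _ = X](_ : _ =
   \int[mu]_t (((fun t => f t * \int[mu]_(s in A) expR (- (s *
       t))) \_ D) t)%:E)%E; last first.
  by apply: eq_integral => t _; rewrite -inner2.
move=> /(congr1 fine) h; rewrite [LHS]Rintegral_mkcond [RHS]Rintegral_mkcond.
exact: h.
Qed.

End Slab.
End Laplace.

(** * Exponential moments from the Laplace transform *)

Section LaplaceBounds.
Context {R : realType} (a b : R) (ha : 0 < a).
Local Notation mu := (@lebesgue_measure R).
Local Notation D := (`[a, b]%classic : set R).
Local Notation T := (measurableTypeR R).

Let mD : measurable (D : set T). Proof. exact: measurable_itv. Qed.

Lemma itvD_gt0 (t : R) : D t -> 0 < t.
Proof. by rewrite /= in_itv/= => /andP[h _]; exact: lt_le_trans h. Qed.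

Variable f : R -> R.
Hypothesis fi : integ mu D f.

Lemma truncated_laplace_le (s : R) : 0 <= s ->
  `|truncated_laplace a b f s| <= expR (- (a * s)) * \int[mu]_(t in D) `|f t|.
Proof.
move=> s0.
have cE := @continuous_expRZ R s.
have le1 t : D t -> `|expR (- (s * t))| <= expR (- (a * s)).
  move=> Dt; rewrite ger0_norm ?expR_ge0// ler_expR lerN2 mulrC ler_wpM2l//.
  by move: Dt; rewrite /= in_itv/= => /andP[].
have ft : integ mu D (fun t => expR (- (s * t)) * f t).
  rewrite (_ : (fun t => _) = (fun t => f t * expR (- (s * t)))); last first.
    by apply/funext => t; rewrite mulrC.
  by apply: (@integ_mulb _ _ _ mu D mD _ _ (expR (- (a * s)))) => //;
     apply: measurable_continuous.
rewrite /truncated_laplace (le_trans (le_normr_Rintegral _ _))//.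
rewrite -RintegralZl//; last exact: integ_norm.
apply: le_Rintegral => //.
- exact: integ_norm.
- by apply: integZ => //; exact: integ_norm.
- by move=> t Dt; rewrite normrM ler_wpM2r// le1.
Qed.

(** Without square integrability the norm of the transform would be 0 by
    convention, and the estimate would fail. *)
Lemma sq_integ_truncated_laplace :
  sq_integ mu `[0, +oo[ (truncated_laplace a b f).
Proof.
have mA : measurable (`[0%R, +oo[%classic : set T) by exact: measurable_itv.
have gi := integ_truncated_laplace ha fi mA (@subset_refl _ _).
have mg := integ_measurable gi; split => //.
pose C := \int[mu]_(t in D) `|f t|.
have a2 : 0 < 2 * a by rewrite mulr_gt0.
apply: (@integ_le _ _ _ mu _ mA _ (fun s => C ^+ 2 * expR (- (2 * a * s)))).
- exact: measurable_funX.
- by apply: integZ => //; exact: integ_expR_half_line.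
- move=> s; rewrite /= in_itv/= andbT => s0.
  have -> : C ^+ 2 * expR (- (2 * a * s)) = (expR (- (a * s)) * C) ^+ 2.
    by rewrite exprMn -expRM_natl mulrC; congr (expR _ * _); ring.
  by rewrite normrX lerXn2r ?nnegrE ?truncated_laplace_le//
    (le_trans _ (truncated_laplace_le s0)).
Qed.

(** The integral of exp(-st) over s in [0, 1]. *)
Definition laplace_weight (t : R) : R := (1 - expR (- t)) / t.

Lemma Rintegral_unit_expR (k : nat) (t : R) : 0 < t ->
  \int[mu]_(s in `[k%:R, k.+1%:R]) expR (- (s * t)) =
      laplace_weight t * expR (- (k%:R * t)).
Proof.
move=> t0; pose F (s : R) := - t^-1 * expR (- (t * s)).
have dF (s : R) : is_derive s 1 F (expR (- (s * t))).
  have dl := is_derive_mul (is_derive_cst t s 1) (is_derive_id s 1).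
  have dE := is_derive_comp (is_derive_expR _) (is_deriveN dl).
  refine (is_derive_eq (is_derive_mul (is_derive_cst (- t^-1) s 1) dE) _).
  rewrite /cst !mul0r !add0r mulr1 [s * t]mulrC; field; rewrite gt_eqF//.
rewrite (Rintegral_derive _ dF).
- rewrite /F /laplace_weight -natr1 mulrDr mulr1 opprD expRD [t * _]mulrC.
  by field; rewrite gt_eqF.
- by rewrite ltr_nat.
- under eq_fun do rewrite mulrC; exact: continuous_expRZ.
Qed.

Lemma measurable_laplace_weight : measurable_fun D laplace_weight.
Proof.
apply: (@measurable_funS _ _ _ _ (`]0%R, +oo[%classic : set T)).
- exact: measurable_itv.
- by move=> t Dt; rewrite /= in_itv/= itvD_gt0.
apply: open_continuous_measurable_fun; first exact: interval_open.
have c1 : continuous (fun t : R => expR (- t)).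
  have -> : (fun t : R => expR (- t)) = (fun t => expR (- (1 * t))).
    by apply/funext => x; rewrite mul1r.
  exact: continuous_expRZ.
move=> t; rewrite inE/= in_itv/= andbT => t0; apply: cvgM.
  by apply: cvgB; [exact: cvg_cst|exact: c1].
by apply: cvgV; [rewrite gt_eqF|exact: cvg_id].
Qed.

Lemma laplace_weight_le1 (t : R) : D t -> laplace_weight t <= 1.
Proof.
move=> /itvD_gt0 t0; rewrite ler_pdivrMr// mul1r.
by have := expR_ge1Dx (- t); lra.
Qed.

Lemma laplace_weight_ge (t : R) : D t -> (1 - expR (- a)) / b <=
    laplace_weight t.
Proof.
move=> Dt; have t0 := itvD_gt0 Dt.
move: Dt; rewrite /= in_itv/= => /andP[at_ tb].
apply: ler_pM.
- by rewrite subr_ge0 -[leRHS]expR0 ler_expR oppr_le0 ltW.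
- by rewrite invr_ge0 (le_trans _ tb)// ltW.
- by rewrite lerD2l lerN2 ler_expR lerN2.
- by rewrite lef_pV2// posrE (lt_le_trans t0).
Qed.

(** Averaging the transform over [k, k + 1] instead of evaluating it at k makes
    the moment continuous for the L2 norm; the price is the weight. *)
Lemma laplace_exp_moment_le (k : nat) :
  `|\int[mu]_(t in D) (f t * (laplace_weight t * expR (- (k%:R * t))))| <=
  L2norm `[0, +oo[ (truncated_laplace a b f).
Proof.
pose A := `[k%:R, k.+1%:R]%classic : set T.
have mA : measurable A by exact: measurable_itv.
have AI : A `<=` `[0%R, +oo[%classic.
  by move=> s; rewrite /A/= !in_itv/= andbT => /andP[h _];
      rewrite (le_trans _ h).
set g := truncated_laplace a b f.
have -> : \int[mu]_(t in D) (f t * (laplace_weight t * expR (- (k%:R * t)))) =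
    \int[mu]_(s in A) g s.
  rewrite (Rintegral_truncated_laplace ha fi mA AI).
  apply: eq_Rintegral => t; rewrite inE => Dt.
  by rewrite Rintegral_unit_expR// itvD_gt0.
have [mg g2] := sq_integ_truncated_laplace.
have sg : sq_integ mu A g.
  split; first exact: measurable_funS mg.
  by apply: integrableS g2 => //; exact: measurable_itv.
have s1 : sq_integ mu A (fun=> 1).
  by apply: sq_integ_continuous => s; exact: cvg_cst.
have := cauchy_schwarz mA sg s1.
under eq_Rintegral do rewrite mulr1.
have -> : \int[mu]_(t in A) ((fun=> 1) t ^+ 2 : R) = 1.
  under eq_Rintegral do rewrite expr1n.
  have kk : k%:R < k.+1%:R :> R by rewrite ltr_nat.
  rewrite (Rintegral_derive kk (fun t : R => is_derive_id t 1)).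
    by rewrite -natr1 addrAC subrr add0r.
  by move=> s; exact: cvg_cst.
rewrite mulr1 => h.
rewrite -(@ler_pXn2r _ 2)// ?nnegrE ?L2norm_ge0// real_normK ?num_real//.
rewrite L2norm_sqr (le_trans h)//.
rewrite [leLHS]Rintegral_mkcond [leRHS]Rintegral_mkcond.
have mI : measurable (`[0%R, +oo[%classic : set T) by exact: measurable_itv.
apply: le_Rintegral => //.
- have [_] := sg; rewrite /integ (integrable_mkcond _ mA).
  by rewrite restrict_EFin.
- move: g2; rewrite /integ (integrable_mkcond _ mI).
  by rewrite restrict_EFin.
- move=> s _; rewrite !patchE; case: ifPn => [/set_mem/AI h'|_].
    by rewrite mem_set.
  by case: ifP => _ //; exact: sqr_ge0.
Qed.

End LaplaceBounds.

(** * Legendre expansion and Bessel inequality *)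

Section Coefficients.
Context {R : realType} (a b : R) (ab : a < b).
Local Notation mu := (@lebesgue_measure R).
Local Notation D := (`[a, b]%classic : set R).
Local Notation T := (measurableTypeR R).
Local Notation L n := (legendre n : {poly R}).
Local Notation coord := (coord a b).
Local Notation density := (density a b).
Local Notation coord_int := (coord_int a b).

Let mD : measurable (D : set T). Proof. exact: measurable_itv. Qed.

Variable f : R -> R.
Hypothesis sf : sq_integ mu D f.

Let fi : integ mu D f.
Proof. by apply: sq_integ_integ => //; exact: lebesgue_itv_lty. Qed.

Lemma integ_mul_continuous (g h : R -> R) : integ mu D g -> continuous h ->
  integ mu D (fun t => g t * h t).
Proof.
move=> gi ch; have [K _ hK] := continuous_bounded_itv a b ch.
apply: (@integ_mulb _ _ _ mu _ mD g h K gi) => [|t Dt].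
  exact: measurable_continuous.
by apply: hK; rewrite inE.
Qed.

Definition legendre_moment n : R :=
    \int[mu]_(t in D) (f t * ((L n).[coord t] * density t)).

Definition legendre_sum (c : nat -> R) M : {poly R} := \sum_(k < M) c k *: L k.

Lemma coord_int_legendre_sum (c : nat -> R) M n : (n < M)%N ->
  coord_int (L n * legendre_sum c M) = c n * (n.*2.+1)%:R^-1.
Proof.
move=> nM; rewrite /legendre_sum mulr_sumr linear_sum/=.
rewrite (bigD1 (Ordinal nM))//= [X in _ + X]big1 ?addr0.
  rewrite -scalerAr linearZ/=.
  by rewrite (legendre_norm (coord_int_deriv ab)).
move=> k /eqP/val_eqP/= kn.
by rewrite -scalerAr linearZ/= (legendre_orth (coord_int_deriv ab)) ?scaler0//
    eq_sym.
Qed.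

Lemma Rintegral_mul_legendre_sum (c : nat -> R) M :
  \int[mu]_(t in D) (f t * ((legendre_sum c M).[coord t] * density t)) =
  \sum_(k < M) c k * legendre_moment k.
Proof.
transitivity (\int[mu]_(t in D) \sum_(k < M) c k * (f t * ((L k).[coord t] *
    density t))).
  apply: eq_Rintegral => t _;
      rewrite /legendre_sum horner_sum mulr_suml mulr_sumr.
  by apply: eq_bigr => k _; rewrite hornerZ; ring.
have ik k : integ mu D (fun t => f t * ((L k).[coord t] * density t)).
  by apply: integ_mul_continuous => //; exact: continuous_poly_coord_density.
rewrite Rintegral_sum//; last by move=> k; exact: integZ.
by apply: eq_bigr => k _; rewrite RintegralZl//; exact: ik.
Qed.

(** Expansion of the square, using orthogonality. *)
Lemma sq_dist_legendre_sum (c : nat -> R) M :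
  \int[mu]_(t in D) ((f t - (legendre_sum c M).[coord t]) ^+ 2 * density t) =
  \int[mu]_(t in D) (f t ^+ 2 * density t) +
  \sum_(k < M) (c k ^+ 2 * (k.*2.+1)%:R^-1 - 2 * (c k * legendre_moment k)).
Proof.
set p := legendre_sum c M.
have i1 : integ mu D (fun t => f t ^+ 2 * density t).
  by apply: integ_mul_continuous; [case: sf|exact: continuous_density].
have i2 : integ mu D (fun t => f t * (p.[coord t] * density t)).
  by apply: integ_mul_continuous => //; exact: continuous_poly_coord_density.
transitivity (\int[mu]_(t in D) (f t ^+ 2 * density t +
    ((p * p).[coord t] * density t - 2 * (f t * (p.[coord t] * density t))))).
  by apply: eq_Rintegral => t _; rewrite hornerM; ring.
have i3 := @integ_poly_coord_density R a b (p * p).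
rewrite RintegralD//; last by apply: integB => //; exact: integZ.
rewrite RintegralB//; last exact: integZ.
rewrite RintegralZl// Rintegral_mul_legendre_sum -/(coord_int _); congr (_ + _).
rewrite big_split/= sumrN -mulr_sumr; congr (_ - _).
rewrite {1}/p /legendre_sum mulr_suml linear_sum/=; apply: eq_bigr => k _.
by rewrite -scalerAl linearZ/= coord_int_legendre_sum// expr2 -mulrA.
Qed.

Definition legendre_fourier n : R := (n.*2.+1)%:R * legendre_moment n.

Lemma sq_dist_legendre_fourier M :
  \int[mu]_(t in D) ((f t -
      (legendre_sum legendre_fourier M).[coord t]) ^+ 2 * density t) =
  \int[mu]_(t in D) (f t ^+ 2 * density t) -
  \sum_(k < M) (k.*2.+1)%:R * legendre_moment k ^+ 2.
Proof.
rewrite sq_dist_legendre_sum -sumrN; congr (_ + _); apply: eq_bigr => k _.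
by rewrite /legendre_fourier; field; rewrite gt_eqF// ltr0n.
Qed.

(** The difference of the two sides is a sum of squares. *)
Lemma legendre_fourier_best (c : nat -> R) M :
  \int[mu]_(t in D) ((f t -
      (legendre_sum legendre_fourier M).[coord t]) ^+ 2 * density t) <=
  \int[mu]_(t in D) ((f t - (legendre_sum c M).[coord t]) ^+ 2 * density t).
Proof.
rewrite sq_dist_legendre_fourier sq_dist_legendre_sum lerD2l -sumrN ler_sum//
    => k _.
have k0 : 0 < (k.*2.+1)%:R :> R by rewrite ltr0n.
rewrite -subr_ge0 (_ : _ - _ =
  (k.*2.+1)%:R * (legendre_moment k - c k * (k.*2.+1)%:R^-1) ^+ 2); last first.
  by field; rewrite gt_eqF.
by apply: mulr_ge0; [exact: ltW|exact: sqr_ge0].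
Qed.

Lemma sum_legendre_moment_le M : \sum_(k < M) (k.*2.+1)%:R *
    legendre_moment k ^+ 2 <=
  density a * \int[mu]_(t in D) (f t ^+ 2).
Proof.
have h : 0 <= \int[mu]_(t in D) ((f t -
    (legendre_sum legendre_fourier M).[coord t]) ^+ 2 * density t).
  apply: Rintegral_ge0 => t _; rewrite mulr_ge0 ?sqr_ge0// ltW//;
      exact: density_gt0.
move: h; rewrite sq_dist_legendre_fourier subr_ge0 => /le_trans; apply.
have [_ f2] := sf; rewrite -RintegralZl//; apply: le_Rintegral => //.
- by apply: integ_mul_continuous => //; exact: continuous_density.
- exact: integZ.
- by move=> t Dt; rewrite mulrC ler_wpM2r ?sqr_ge0//; exact: density_le.
Qed.

Section Derivative.
Variable fx : R -> R.
Hypotheses (sfx : sq_integ mu D fx) (wd : weak_derivative a b f fx).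

Let fxi : integ mu D fx.
Proof. by apply: sq_integ_integ => //; exact: lebesgue_itv_lty. Qed.

(** The eigenfunction equation turns P_n into a derivative, which is then moved
    onto f. *)
Lemma legendre_moment_derivative n : (n * n.+1)%:R * legendre_moment n =
  - \int[mu]_(t in D) (fx t * ('X * (1 - 'X) * (L n)^`()).[coord t]).
Proof.
set q := 'X * (1 - 'X) * (L n)^`().
have q0 : q.[0] = 0 by rewrite /q !hornerM hornerX !mul0r.
have q1 : q.[1] = 0.
  by rewrite /q !hornerM hornerD hornerN hornerX [_.[1]]hornerC subrr mulr0
      mul0r.
have := @weak_derivative_poly_expRN _ a b f fx (q \Po coordP a b) fi fxi wd.
rewrite -!horner_coord coord_a// coord_b q0 q1 => /(_ erefl erefl) e.
under [in RHS]eq_Rintegral do rewrite horner_coord.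
rewrite -e /legendre_moment -RintegralZl//; last first.
  by apply: integ_mul_continuous => //; exact: continuous_poly_coord_density.
apply: eq_Rintegral => t _.
have d1 := is_derive_poly_expRN (q \Po coordP a b) t.
have d2 := is_derive_poly_coord a b q t.
have -> : ('X * - (q \Po coordP a b)^`()).[expR (- t)] =
    - (q^`().[coord t] * density t).
  rewrite -(@derive_val _ _ _ _ _ _ _ d1) -(@derive_val _ _ _ _ _ _ _ d2).
  by congr ('D_1 _ t); apply/funext => x; rewrite horner_coord.
by rewrite legendre_ode hornerZ; ring.
Qed.

(** Let H be the derivative of the M-th partial sum of the expansion of f. The
    integral of f'^2 / density(b) + 2 f' x (1 - x) H + x (1 - x) H^2 density is
    nonnegative, since the integrand dominates a square; in it, the mixed term
    is -2 times the sum on the left and the last term is that sum once. *)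
Lemma bessel_derivative M :
  \sum_(n < M) (n * n.+1)%:R * (n.*2.+1)%:R * legendre_moment n ^+ 2 <=
  (density b)^-1 * \int[mu]_(t in D) (fx t ^+ 2).
Proof.
pose Q : {poly R} := 'X * (1 - 'X).
pose q := legendre_sum legendre_fourier M.
have [_ fx2] := sfx.
have rb := density_gt0 ab b.
have iQ (p : {poly R}) : integ mu D (fun t => fx t * (Q * p).[coord t]).
  by apply: integ_mul_continuous => //; exact: continuous_poly_coord.
have e1 : \int[mu]_(t in D) (fx t * (Q * q^`()).[coord t]) =
    - \sum_(n < M) (n * n.+1)%:R * (n.*2.+1)%:R * legendre_moment n ^+ 2.
  transitivity (\int[mu]_(t in D)
      \sum_(n < M) legendre_fourier n * (fx t * (Q * (L n)^`()).[coord t])).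
    apply: eq_Rintegral => t _;
        rewrite /q /legendre_sum raddf_sum/= !mulr_sumr horner_sum.
    rewrite mulr_sumr; apply: eq_bigr => n _.
    by rewrite derivZ -scalerAr hornerZ; ring.
  rewrite (Rintegral_sum mD); last by move=> n; exact: integZ.
  rewrite -sumrN; apply: eq_bigr => n _.
  rewrite (@RintegralZl _ _ _ mu D _ _ mD (iQ _)).
  rewrite -[X in _ * X]opprK -legendre_moment_derivative /legendre_fourier;
      ring.
have e2 : coord_int (Q * q^`() * q^`()) =
    \sum_(n < M) (n * n.+1)%:R * (n.*2.+1)%:R * legendre_moment n ^+ 2.
  have dq : q^`() = \sum_(n < M) legendre_fourier n *: (L n)^`().
    rewrite /q /legendre_sum raddf_sum; by apply: eq_bigr => k _; exact: derivZ.
  rewrite {1}dq mulr_sumr mulr_suml linear_sum/=.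
  apply: eq_bigr => n _; rewrite -scalerAr -scalerAl linearZ/=.
  rewrite (legendre_parts (coord_int_deriv ab))/= /q coord_int_legendre_sum//
      /legendre_fourier/GRing.scale/=.
  by field; rewrite gt_eqF// ltr0n.
have i3 := @integ_poly_coord_density R a b (Q * q^`() * q^`()).
have : 0 <= \int[mu]_(t in D) ((density b)^-1 * fx t ^+ 2 +
    (2 * (fx t * (Q * q^`()).[coord t]) +
        (Q * q^`() * q^`()).[coord t] * density t)).
  apply: Rintegral_ge0 => t Dt.
  have /andP[s0 s1] := coord_itv ab Dt.
  have rt := density_ge ab Dt.
  have hQ : Q.[coord t] = coord t * (1 - coord t).
    by rewrite hornerM hornerD hornerN hornerX [X in X - _]hornerC.
  rewrite [(Q * q^`() * _).[_]]hornerM [(Q * _).[_]]hornerM hQ.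
  set h := q^`().[coord t].
  set s := coord t; set u := s * (1 - s).
  have u0 : 0 <= u by rewrite mulr_ge0// subr_ge0.
  have u1 : u <= 1 by rewrite /u; nra.
  apply: (@le_trans _ _ ((density b)^-1 * (fx t + density b * (u * h)) ^+ 2)).
    by rewrite mulr_ge0 ?sqr_ge0// invr_ge0 ltW.
  have -> : (density b)^-1 * (fx t + density b * (u * h)) ^+ 2 =
     (density b)^-1 * fx t ^+ 2 + (2 * (fx t * (u * h)) +
         u * (u * (density b)) * h ^+ 2).
    by field; rewrite gt_eqF.
  rewrite lerD2l lerD2l.
  have -> : u * h * h * density t = u * density t * h ^+ 2 by ring.
  rewrite ler_wpM2r ?sqr_ge0// ler_wpM2l//.
  by rewrite (le_trans _ rt)// ler_piMl// ltW.
have j1 : integ mu D (fun t => (density b)^-1 * fx t ^+ 2) by exact: integZ.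
have j2 : integ mu D (fun t =>
    2 * (fx t * (Q * q^`()).[coord t])) by exact: integZ.
rewrite (RintegralD mD j1 (integD mD j2 i3)) (RintegralD mD j2 i3).
rewrite (RintegralZl _ mD fx2) (RintegralZl _ mD (iQ _)) e1 -/(coord_int _) e2.
lra.
Qed.

End Derivative.
End Coefficients.

(** * The truncated expansion and its moments *)

Section Main.
Context {R : realType} (a b : R) (ha : 0 < a) (ab : a < b).
Local Notation mu := (@lebesgue_measure R).
Local Notation D := (`[a, b]%classic : set R).
Local Notation T := (measurableTypeR R).
Local Notation L n := (legendre n : {poly R}).
Local Notation coord := (coord a b).
Local Notation density := (density a b).

Let mD : measurable (D : set T). Proof. exact: measurable_itv. Qed.

Variable f : R -> R.
Hypothesis sf : sq_integ mu D f.

Let fi : integ mu D f.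
Proof. by apply: sq_integ_integ => //; exact: lebesgue_itv_lty. Qed.

Local Notation legendre_fourier := (legendre_fourier a b f).
Local Notation legendre_moment := (legendre_moment a b f).

(** For M >= N large, the M-th partial sum is within epsilon of f by density, and
    the terms between N and M are bounded by those of Bessel's inequality divided
    by N^2. *)
Lemma legendre_fourier_dist (fx : R -> R) N : sq_integ mu D fx ->
  weak_derivative a b f fx -> (0 < N)%N ->
  \int[mu]_(t in D) ((f t -
      (legendre_sum legendre_fourier N).[coord t]) ^+ 2 * density t) <=
  (density b)^-1 * \int[mu]_(t in D) (fx t ^+ 2) / N%:R ^+ 2.
Proof.
move=> sfx wd N0; apply/ler_addgt0Pr => e e0.
have ra := density_gt0 ab a.
have era : 0 < e / density a by rewrite divr_gt0.
have [q qe] := approximable_sq_integ ab sf era.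
pose M := maxn (size q) N.
have [c qc] := legendre_span (leq_maxl (size q) N).
have h1 : \int[mu]_(t in D) ((f t -
    (legendre_sum legendre_fourier M).[coord t]) ^+ 2 * density t) <= e.
  apply: le_trans (legendre_fourier_best ab sf c M) _.
  rewrite -[legendre_sum c M]qc.
  have sq : sq_integ mu D (fun t => f t - q.[coord t]).
    by apply: sq_integB => //; apply: sq_integ_continuous;
        exact: continuous_poly_coord.
  have [_ sq2] := sq.
  apply: (@le_trans _ _ (density a * \int[mu]_(t in D) ((f t -
      q.[coord t]) ^+ 2))).
    rewrite -RintegralZl//; apply: le_Rintegral => //.
    - by apply: integ_mul_continuous => //; exact: continuous_density.
    - exact: integZ.
    - by move=> t Dt; rewrite mulrC ler_wpM2r ?sqr_ge0//; exact: density_le.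
  by rewrite mulrC -ler_pdivlMr.
have h2 := bessel_derivative ab sf sfx wd M.
move: h1; rewrite !(sq_dist_legendre_fourier ab sf).
set F := \int[mu]_(t in D) (f t ^+ 2 * density t).
set Y := (density b)^-1 * _ in h2 *.
have NM : (N <= M)%N by exact: leq_maxr.
pose g k := k.*2.+1%:R * legendre_moment k ^+ 2.
have split_sum (u : nat -> R) : \sum_(k < M) u k =
    \sum_(k < N) u k + \sum_(N <= k < M) u k.
  by rewrite -!(big_mkord xpredT) -big_cat_nat.
rewrite (split_sum g) => h1.
have h3 : N%:R ^+ 2 * \sum_(N <= k < M) g k <= Y.
  apply: le_trans h2; rewrite (split_sum (fun n =>
      (n * n.+1)%:R * n.*2.+1%:R * legendre_moment n ^+ 2)).
  rewrite ler_wpDl//.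
    by apply: sumr_ge0 => k _; apply: mulr_ge0; rewrite ?sqr_ge0// mulr_ge0.
  rewrite mulr_sumr !big_nat; apply: ler_sum => k /andP[Nk _].
  rewrite /g -mulrA ler_wpM2r//.
    by apply: mulr_ge0; rewrite ?sqr_ge0.
  rewrite -natrX ler_nat -mulnn leq_mul//.
  by rewrite (leq_trans Nk).
have h4 : \sum_(N <= k < M) g k <= Y / N%:R ^+ 2.
  by rewrite ler_pdivlMr ?exprn_gt0 ?ltr0n// mulrC.
rewrite -/g; lra.
Qed.

Let G := L2norm `[0, +oo[ (truncated_laplace a b f).

Definition weighted_moment (p : {poly R}) : R :=
  \int[mu]_(t in D) (f t * (laplace_weight t * p.[coord t])).

Lemma laplace_weight_ge0 (t : R) : D t -> 0 <= laplace_weight t.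
Proof.
move=> Dt; apply: le_trans (laplace_weight_ge ha Dt).
rewrite divr_ge0//; first
    by rewrite subr_ge0 -[leRHS]expR0 ler_expR oppr_le0 ltW.
by rewrite (le_trans _ (ltW ab))// ltW.
Qed.

Lemma integ_laplace_weight (h : R -> R) : continuous h ->
  integ mu D (fun t => f t * (laplace_weight t * h t)).
Proof.
move=> ch; have [K K0 hK] := continuous_bounded_itv a b ch.
apply: (@integ_mulb _ _ _ mu _ mD f _ K fi).
  apply: measurable_funM; first exact: (measurable_laplace_weight ha).
  exact: measurable_continuous.
move=> t Dt; rewrite normrM (ger0_norm (laplace_weight_ge0 Dt)).
rewrite -[K]mul1r ler_pM ?(laplace_weight_ge0 Dt)//.
  exact: (laplace_weight_le1 ha Dt).
by apply: hK; rewrite inE.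
Qed.

Lemma weighted_moment_sum (I : Type) (s : seq I) (c : I -> R) (p : I -> {poly
    R}) :
  weighted_moment (\sum_(i <- s) c i *: p i) =
      \sum_(i <- s) c i * weighted_moment (p i).
Proof.
have ip i : integ mu D (fun t => f t * (laplace_weight t * (p i).[coord t])).
  by apply: integ_laplace_weight; exact: continuous_poly_coord.
transitivity (\int[mu]_(t in D)
    \sum_(i <- s) c i * (f t * (laplace_weight t * (p i).[coord t]))).
  apply: eq_Rintegral => t _; rewrite horner_sum !mulr_sumr.
  by apply: eq_bigr => i _; rewrite hornerZ; ring.
rewrite (Rintegral_sum mD); last by move=> i; exact: integZ.
by apply: eq_bigr => i _; rewrite (RintegralZl _ mD (ip i)).
Qed.

(** The sum of the absolute values of the coefficients of [coord] as a polynomial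
    in exp(-t). *)
Definition coord_size : R := coord_scale a b * (1 + expR (- b)).

(** The binomial expansion of the k-th power of [coord] in powers of exp(-t). *)
Lemma weighted_moment_Xn k : `|weighted_moment 'X^k| <= coord_size ^+ k * G.
Proof.
pose c (i : nat) : R :=
    coord_scale a b ^+ k * ((- expR (- b)) ^+ (k - i) *+ 'C(k, i)).
have ci i : integ mu D (fun t =>
    f t * (laplace_weight t * expR (- (i%:R * t)))).
  by apply: integ_laplace_weight; exact: continuous_expRZ.
have -> : weighted_moment 'X^k = \sum_(i < k.+1)
    c i * \int[mu]_(t in D) (f t * (laplace_weight t * expR (- (i%:R * t)))).
  transitivity (\int[mu]_(t in D) \sum_(i < k.+1)
    c i * (f t * (laplace_weight t * expR (- (i%:R * t))))).
    apply: eq_Rintegral => t _; rewrite hornerXn coordE exprMn.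
    rewrite [expR (- t) - _]addrC exprDn !mulr_sumr.
    apply: eq_bigr => i _; rewrite -mulrN expRM_natl /c.
    rewrite -[(_ * _) *+ _]mulr_natr -[(_ ^+ _) *+ 'C(_, _)]mulr_natr; ring.
  rewrite (Rintegral_sum mD); last by move=> i; exact: integZ.
  by apply: eq_bigr => i _; rewrite (RintegralZl _ mD (ci i)).
apply: (le_trans (ler_norm_sum _ _ _)).
apply: (@le_trans _ _ (\sum_(i < k.+1) `|c i| * G)).
  apply: ler_sum => i _; rewrite normrM ler_wpM2l//.
  have h := laplace_exp_moment_le ha fi i. exact: h.
rewrite -mulr_suml ler_wpM2r ?L2norm_ge0//.
rewrite /coord_size exprMn [1 + _]addrC exprDn mulr_sumr ler_sum// => i _.
have k0 := coord_scale_gt0 ab.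
rewrite /c expr1n mulr1 normrM ger0_norm ?exprn_ge0 ?(ltW k0)// ler_wpM2l//.
  by rewrite exprn_ge0// ltW.
by rewrite normrMn normrX normrN ger0_norm ?expR_ge0.
Qed.

Lemma weighted_moment_legendre n : `|weighted_moment (L n)| <=
    (4 * (1 + coord_size)) ^+ n * G.
Proof.
have s0 : 0 <= coord_size.
  by rewrite mulr_ge0 ?addr_ge0 ?expR_ge0// ltW// coord_scale_gt0.
have -> : weighted_moment (L n) =
    \sum_(k < n.+1) (L n)`_k * weighted_moment 'X^k.
  rewrite -weighted_moment_sum; congr weighted_moment.
  rewrite -poly_def; apply/polyP => k; rewrite [RHS]coef_poly.
  case: ltnP => // nk.
  by apply: nth_default; apply: leq_trans nk; exact: size_legendre.
apply: (le_trans (ler_norm_sum _ _ _)).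
apply: (@le_trans _ _ (\sum_(k < n.+1) `|(L n)`_k| * coord_size ^+ k * G)).
  by apply: ler_sum => k _;
      rewrite normrM -mulrA ler_wpM2l// weighted_moment_Xn.
by rewrite -mulr_suml ler_wpM2r ?L2norm_ge0// legendre_coef_bound.
Qed.

Lemma legendre_moment_le n : `|legendre_moment n| <=
    (1 + density a) * L2norm `[a, b] f.
Proof.
have ra := ltW (density_gt0 ab a).
have h := sum_legendre_moment_le ab sf n.+1.
rewrite -(@ler_pXn2r _ 2)// ?nnegrE ?mulr_ge0 ?addr_ge0 ?L2norm_ge0//.
rewrite real_normK ?num_real// exprMn L2norm_sqr.
apply: (@le_trans _ _ (density a * \int[mu]_(t in D) (f t ^+ 2))).
  apply: le_trans h; rewrite big_ord_recr/= ler_wpDl//.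
    by apply: sumr_ge0 => k _; apply: mulr_ge0; rewrite ?sqr_ge0.
  by rewrite ler_peMl ?sqr_ge0// ler1n.
rewrite ler_wpM2r//; first by apply: Rintegral_ge0 => t _; exact: sqr_ge0.
nra.
Qed.

(** The factor 2 n + 1 of the expansion is absorbed in 3^n, and the geometric sum
    in one more power of its ratio. *)
Lemma moment_legendre_fourier_le N : `|weighted_moment (legendre_sum
    legendre_fourier N)| <=
  (1 + density a) * L2norm `[a, b] f * (12 * (1 + coord_size)) ^+ N * G.
Proof.
have s0 : 0 <= coord_size.
  by rewrite mulr_ge0 ?addr_ge0 ?expR_ge0// ltW// coord_scale_gt0.
set A := (1 + density a) * _; set Y := 12 * _.
have A0 : 0 <= A by rewrite mulr_ge0 ?L2norm_ge0// addr_ge0// ltW// density_gt0.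
have Y2 : 2 <= Y by rewrite /Y; lra.
rewrite /legendre_sum weighted_moment_sum (le_trans (ler_norm_sum _ _ _))//.
apply: (@le_trans _ _ (\sum_(n < N) A * G * Y ^+ n)).
  apply: ler_sum => n _; rewrite normrM /legendre_fourier normrM normr_nat.
  have -> : A * G * Y ^+ n = 3 ^+ n * A * ((4 * (1 + coord_size)) ^+ n * G).
    have -> : Y = 3 * (4 * (1 + coord_size)) by rewrite /Y; ring.
    by rewrite [in LHS]exprMn; ring.
  rewrite ler_pM ?mulr_ge0 ?weighted_moment_legendre//.
  rewrite ler_pM ?legendre_moment_le// -natrX ler_nat.
  by elim: (n : nat) => // m IH; rewrite expnS doubleS; lia.
rewrite -mulr_sumr [leRHS]mulrAC ler_wpM2l ?mulr_ge0 ?L2norm_ge0//.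
  by rewrite addr_ge0// ltW// density_gt0.
elim: N => [|N IH]; first by rewrite big_ord0 expr0.
rewrite big_ord_recr/= exprS (le_trans (lerD IH (lexx _)))//.
have : 0 <= Y ^+ N by rewrite exprn_ge0// (le_trans _ Y2).
by move: Y2; move: (Y ^+ N) => z; nra.
Qed.

End Main.

(** * The stability estimate *)

Section Conclusion.
Context {R : realType} (a b : R) (ha : 0 < a) (ab : a < b).
Local Notation mu := (@lebesgue_measure R).
Local Notation D := (`[a, b]%classic : set R).
Local Notation T := (measurableTypeR R).
Local Notation coord := (coord a b).
Local Notation density := (density a b).

Let mD : measurable (D : set T). Proof. exact: measurable_itv. Qed.

Definition weight_min : R := (1 - expR (- a)) / b.

Lemma weight_min_gt0 : 0 < weight_min.
Proof.
rewrite divr_gt0//; last exact: lt_trans ab.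
by rewrite subr_gt0 -[ltRHS]expR0 ltr_expR oppr_lt0.
Qed.

(** Pointwise f w p >= (w/2) f^2 - (w/2) (f - p)^2, and the weight w lies between
    [weight_min] and 1. *)
Lemma weighted_moment_ge (f : R -> R) (p : {poly R}) : sq_integ mu D f ->
  weight_min / 2 * \int[mu]_(t in D) (f t ^+ 2) -
  (2 * weight_min * density b)^-1 * \int[mu]_(t in D) ((f t -
      p.[coord t]) ^+ 2 * density t)
  <= weighted_moment a b f p.
Proof.
move=> sf; have [_ f2] := sf; have w0 := weight_min_gt0;
    have r0 := density_gt0 ab b.
have sp : sq_integ mu D (fun t => f t - p.[coord t]).
  by apply: sq_integB => //; apply: sq_integ_continuous;
      exact: continuous_poly_coord.
have [_ p2] := sp.
have i2 : integ mu D (fun t => (f t - p.[coord t]) ^+ 2 * density t).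
  by apply: integ_mul_continuous => //; exact: continuous_density.
have i1 := integZ mD (weight_min / 2) f2.
have i3 := integZ mD (2 * weight_min * density b)^-1 i2.
rewrite -(RintegralZl _ mD f2) -(RintegralZl _ mD i2) -(RintegralB mD i1 i3).
apply: le_Rintegral => //; first exact: integB.
  by apply: (integ_laplace_weight ha ab sf); exact: continuous_poly_coord.
move=> t Dt; set x := f t; set y := p.[coord t].
have wt1 := laplace_weight_le1 ha Dt; have wt0 := laplace_weight_ge ha Dt.
rewrite -/weight_min in wt0; have rt := density_ge ab Dt.
set w := laplace_weight t in wt0 wt1 *.
have e : (2 * weight_min * density b)^-1 * ((x - y) ^+ 2 * density t) =
    weight_min^-1 / 2 * (x - y) ^+ 2 * (density t / density b).
  by field; rewrite !gt_eqF.
have v1 : 1 <= weight_min^-1 by rewrite invf_ge1// (le_trans wt0).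
have v2 : 1 <= density t / density b by rewrite ler_pdivlMr// mul1r.
have z0 := sqr_ge0 (x - y).
have h1 : w / 2 * (x - y) ^+ 2 <=
    weight_min^-1 / 2 * (x - y) ^+ 2 * (density t / density b).
  apply: (@le_trans _ _ (weight_min^-1 / 2 * (x - y) ^+ 2)).
    by rewrite ler_wpM2r//; lra.
  by rewrite ler_peMr// mulr_ge0//; lra.
have h2 : weight_min / 2 * x ^+ 2 <=
    w / 2 * x ^+ 2 by rewrite ler_wpM2r ?sqr_ge0//; lra.
have h3 : 0 <= w / 2 * y ^+ 2 by rewrite mulr_ge0 ?sqr_ge0//; lra.
rewrite e; have -> : x * (w * y) =
    w / 2 * x ^+ 2 - w / 2 * (x - y) ^+ 2 + w / 2 * y ^+ 2.
  by field.
lra.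
Qed.

(** A degree above [degree_ratio] times |f'| / |f| makes the error term of
    [weighted_moment_ge] at most half of its main term. *)
Definition degree_ratio : R := 2 / (weight_min * density b).

(** Each further degree multiplies the bound on the moments by this factor. *)
Definition moment_growth : R := 12 * (1 + coord_size a b).

Lemma coord_size_gt0 : 0 < coord_size a b.
Proof.
apply: mulr_gt0; first exact: coord_scale_gt0.
by rewrite addr_gt0 ?expR_gt0.
Qed.

Lemma moment_growth_gt1 : 1 < moment_growth.
Proof. by have := coord_size_gt0; rewrite /moment_growth; lra. Qed.

Lemma degree_ratio_gt0 : 0 < degree_ratio.
Proof.
apply: divr_gt0 => //.
by apply: mulr_gt0; [exact: weight_min_gt0|exact: density_gt0].
Qed.

Lemma truncated_laplace_stability (f fx : R -> R) : H1 a b f fx ->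
  weight_min / (4 * (1 + density a) * moment_growth) *
  expR (- (degree_ratio * ln moment_growth) *
    (L2norm `[a, b] fx / L2norm `[a, b] f)) * L2norm `[a, b] f <=
  L2norm `[0, +oo[ (truncated_laplace a b f).
Proof.
move=> [/L2_sq_integ sf /L2_sq_integ sfx wd].
have w0 := weight_min_gt0; have r0 := density_gt0 ab b.
have ra0 := density_gt0 ab a; have Y1 := moment_growth_gt1.
have Y0 : 0 < moment_growth := lt_trans ltr01 Y1.
have K0 := degree_ratio_gt0.
set A := 1 + density a; have A0 : 0 < A by rewrite addr_gt0.
set F := L2norm `[a, b] f; set X := L2norm `[a, b] fx; set G := L2norm _ _.
have F0 : 0 <= F := L2norm_ge0 _ _; have X0 : 0 <= X := L2norm_ge0 _ _.
have G0 : 0 <= G := L2norm_ge0 _ _.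
have [->|Fn0] := eqVneq F 0; first by rewrite mulr0.
have {Fn0} Fp : 0 < F by rewrite lt_def Fn0.
have rX : 0 <= degree_ratio * (X / F) by apply: mulr_ge0;
    [exact: ltW|exact: divr_ge0].
(* the least degree above the threshold; it exceeds it by at most 1 *)
pose N := (Num.truncn (degree_ratio * (X / F))).+1.
have /andP[N1 N2] := truncn_itv rX.
have NK : degree_ratio * (X / F) < N%:R by [].
have NK' : N%:R <= degree_ratio * (X / F) + 1 by rewrite -natr1 lerD2r.
have n0 : 0 < N%:R :> R by rewrite ltr0n.
have dist := legendre_fourier_dist ab sf sfx wd (ltn0Sn _ : 0 < N)%N.
have low := weighted_moment_ge (legendre_sum (legendre_fourier a b f) N) sf.
have up := le_trans (ler_norm _) (moment_legendre_fourier_le ha ab sf N).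
rewrite -/F -/G -/A -/moment_growth in up.
rewrite -!L2norm_sqr -/F -/X in dist low.
have main : weight_min / 4 * F ^+ 2 <= A * F * moment_growth ^+ N * G.
  apply: le_trans up; apply: le_trans low.
  set E := \int[mu]_(t in D) _ in dist *.
  have XN : X * degree_ratio <= N%:R * F.
    have -> : X * degree_ratio = degree_ratio * (X / F) * F by field;
        rewrite gt_eqF.
    by rewrite ler_wpM2r// ltW.
  have XN2 : (X * degree_ratio) ^+ 2 <= (N%:R * F) ^+ 2.
    by rewrite lerXn2r// nnegrE; apply: mulr_ge0 => //; exact: ltW.
  suff : (2 * weight_min * density b)^-1 * E <= weight_min / 4 * F ^+ 2 by lra.
  apply: (@le_trans _ _ ((2 * weight_min * density b)^-1 * ((density b)^-1 *
      X ^+ 2 / N%:R ^+ 2))).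
    rewrite ler_wpM2l// invr_ge0 ltW//.
    by apply: mulr_gt0 => //; exact: mulr_gt0.
  rewrite [leLHS](_ : _ =
      weight_min / 8 * ((X * degree_ratio) ^+ 2 / N%:R ^+ 2)); last first.
    have identity (x r w n : R) : 0 < r -> 0 < w -> 0 < n ->
      (2 * w * r)^-1 * (r^-1 * x ^+ 2 / n ^+ 2) =
      w / 8 * ((x * (2 / (w * r))) ^+ 2 / n ^+ 2).
      by move=> *; field; rewrite !gt_eqF.
    exact: identity.
  rewrite (@le_trans _ _ (weight_min / 8 * F ^+ 2))//.
    apply: ler_wpM2l; first by apply: divr_ge0 => //; exact: ltW.
    by rewrite ler_pdivrMr ?exprn_gt0// -exprMn [F * _]mulrC.
  by rewrite ler_wpM2r ?sqr_ge0//; lra.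
have YN : moment_growth ^+ N <=
    expR (degree_ratio * ln moment_growth * (X / F)) * moment_growth.
  have -> : moment_growth ^+ N = expR (N%:R * ln moment_growth).
    by rewrite expRM_natl lnK// posrE.
  rewrite -[X in _ <= _ * X](@lnK _ moment_growth) ?posrE// -expRD ler_expR.
  have lY : 0 <= ln moment_growth by rewrite ltW// ln_gt0.
  by apply: le_trans (ler_wpM2r lY NK') _; rewrite mulrDl mul1r mulrAC.
have fin : weight_min / 4 * F <=
    A * (expR (degree_ratio * ln moment_growth * (X / F)) * moment_growth) * G.
  apply: (@le_trans _ _ (A * moment_growth ^+ N * G)).
    have reorder (x y z w : R) : x * y * z * w = x * w * y * z by ring.
    rewrite -(ler_pM2r Fp) [leRHS]reorder.
    by move: main; rewrite expr2 mulrA.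
  by rewrite ler_wpM2r// ler_wpM2l// ltW.
rewrite mulNr expRN; set z := expR _ in fin *.
have z0 : 0 < z by exact: expR_gt0.
have -> : weight_min / (4 * A * moment_growth) * z^-1 * F =
    (weight_min / 4 * F) / (A * (z * moment_growth)).
  by field; rewrite !gt_eqF.
have Azg : 0 < A * (z * moment_growth) by apply: mulr_gt0 => //;
    exact: mulr_gt0.
by rewrite ler_pdivrMr// [G * _]mulrC.
Qed.

End Conclusion.

Unset Implicit Arguments.

Theorem theorem1 (R : realType) (a b : R) (ha : 0 < a) (hab : a < b) :
  exists c1 c2 : R, [/\ 0 < c1, 0 < c2 &
    forall f fx : R -> R, H1 a b f fx ->
      ~ {ae (@lebesgue_measure R), forall x, x \in `[a, b] -> f x = 0} ->
      c1 * expR (- c2 * (L2norm `[a, b] fx / L2norm `[a, b] f))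
         * L2norm `[a, b] f
      <= L2norm `[0, +oo[ (truncated_laplace a b f)].
Proof.
have Y1 := moment_growth_gt1 hab.
exists (weight_min a b / (4 * (1 + density a b a) * moment_growth a b)).
exists (degree_ratio a b * ln (moment_growth a b)); split.
- apply: divr_gt0; first exact: weight_min_gt0.
  apply: mulr_gt0; last exact: lt_trans Y1.
  by rewrite mulr_gt0// addr_gt0// density_gt0.
- by apply: mulr_gt0; [exact: degree_ratio_gt0|exact: ln_gt0].
- by move=> f fx H _; exact: truncated_laplace_stability.
Qed.
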